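(* Let $m\ge1$ and let $\sigma=(\sigma_0,\dots,\sigma_m)$ be an alternating sequence of signs. For each $h_0\in[0,\log(m+1)]$ the isentrope $\{\mathbf p\in P^m : h(S_{\mathbf p})=h_0\}$ of the family $(S_{\mathbf p})_{\mathbf p\in P^m}$ of stunted sawtooth maps of shape $\sigma$ is contractible.
   Context: $\sigma_j\in\{\pm1\}$ with $\sigma_{j}=(-1)^j\sigma_0$. Let $P^m=\{(p_1,\dots,p_m)\in[0,1]^m: p_i+p_{i+1}\ge1 \text{ for } 1\le i<m\}$. Stunted sawtooth maps: put $s=m+\tfrac32$, $\alpha=\frac{ms}{s-1}$ (so $m<\alpha<m+1$), $J=[-\alpha,\alpha]$, $\widehat C_j=2j-m-1$ for $1\le j\le m$ and $\widehat I_j=2j-m$ for $0\le j\le m$. The sawtooth map $S:J\to\mathbb R$ is the continuous piecewise linear map with $S(y)=\sigma_j s\,(y-\widehat I_j)$ for $y\in J$, $|y-\widehat I_j|\le 1$, $0\le j\le m$. For $\mathbf p\in P^m$ let $v_j=-(2p_j-1)\sigma_j\alpha\in[-\alpha,\alpha]$ (so $v_j\le v_{j+1}$ if $\sigma_j=+1$ and $v_j\ge v_{j+1}$ if $\sigma_j=-1$, for $0<j<m$). The stunted sawtooth map $S_{\mathbf p}:J\to J$ is defined by $S_{\mathbf p}(y)=v_j$ if $|y-\widehat C_j|\le 1+\sigma_jv_j/s$ for some $1\le j\le m$, and $S_{\mathbf p}(y)=S(y)$ otherwise. It is continuous. $h$ denotes topological entropy. *)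

(* Defs.v *)
From HB Require Import structures.
From mathcomp Require Import all_boot all_order all_algebra.
From mathcomp Require Import finmap.
From mathcomp Require Import all_classical all_reals all_analysis.
From mathcomp Require Import ring lra.

Set Implicit Arguments.
Unset Strict Implicit.
Unset Printing Implicit Defensive.

Import Order.TTheory GRing.Theory Num.Theory.
Import numFieldNormedType.Exports.

Local Open Scope classical_set_scope.
Local Open Scope ring_scope.

(* [contractible] and [topological_entropy] are stated for a subset of an
   ambient space and use only the induced structure on that subset. *)

Definition contractible (R : realType) (T : topologicalType) (A : set T) :=
  exists (c : T) (H : R * T -> T),
    [/\ A c,
        {within `[0, 1] `*` A, continuous H},
        (forall t x, t \in `[0, 1] -> A x -> A (H (t, x))),
        (forall x, A x -> H (0, x) = x) &
        (forall x, A x -> H (1, x) = c)].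

Section Entropy.
Context {R : realType} {T : pseudoMetricType R}.

Definition separated (f : T -> T) (n : nat) (e : R) (E : set T) :=
  forall x y, E x -> E y -> x <> y ->
    exists2 k, (k < n)%N & ~ ball (iter k f x) e (iter k f y).

Definition separated_card (K : set T) (f : T -> T) (n : nat) (e : R) : \bar R :=
  ereal_sup [set (#|` E|%fset%:R)%:E | E in
    [set E : {fset T} | [set` E] `<=` K /\ separated f n e [set` E]]].

(* Bowen-Dinaburg definition, for K compact and f continuous on K with
   f @` K `<=` K *)
Definition topological_entropy (K : set T) (f : T -> T) : \bar R :=
  lim ((limn_esup (fun n => (n%:R^-1)%:E * lne (separated_card K f n e))%E)
       @[e --> 0^'+]).

End Entropy.

Section StuntedSawtooth.
Context {R : realType} {m : nat}.

Definition alternating_signs (sigma : 'I_m.+1 -> R) :=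
  (sigma ord0 = 1 \/ sigma ord0 = -1) /\
  (forall j : 'I_m.+1, sigma j = (-1) ^+ j * sigma ord0).

(* An index 1 <= j <= m is encoded by i : 'I_m with j = i.+1; as an element
   of {0, ..., m} it is lift ord0 i. *)

Definition Pm : set 'rV[R]_m :=
  [set p | (forall i, 0 <= p ord0 i <= 1) /\
           (forall i i' : 'I_m, i' = i.+1 :> nat ->
              1 <= p ord0 i + p ord0 i')].

Definition slope : R := m%:R + 3 / 2.

Definition alpha : R := m%:R * slope / (slope - 1).

Definition J : set R := `[- alpha, alpha].

Definition Chat (i : 'I_m) : R := 2 * (i.+1)%:R - m%:R - 1.

Definition Ihat (j : 'I_m.+1) : R := 2 * j%:R - m%:R.

Variable sigma : 'I_m.+1 -> R.

(* Any choice made by [pick] gives the same value (sawtoothE,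
   stunted_sawtooth_plateau), and only the values on J, which stunted_sawtooth
   maps to itself (stunted_sawtooth_J), are used. *)
Definition sawtooth (y : R) : R :=
  if [pick j : 'I_m.+1 | `|y - Ihat j| <= 1] is Some j
  then sigma j * slope * (y - Ihat j) else 0.

Definition plateau_value (p : 'rV[R]_m) (i : 'I_m) : R :=
  - (2 * p ord0 i - 1) * sigma (lift ord0 i) * alpha.

Definition in_plateau (p : 'rV[R]_m) (y : R) (i : 'I_m) : bool :=
  `|y - Chat i| <= 1 + sigma (lift ord0 i) * plateau_value p i / slope.

Definition stunted_sawtooth (p : 'rV[R]_m) (y : R) : R :=
  if [pick i : 'I_m | in_plateau p y i] is Some i
  then plateau_value p i else sawtooth y.

Hypothesis sigma_alt : alternating_signs sigma.

Lemma sigma_sqr j : sigma j * sigma j = 1.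
Proof.
have [h0 hj] := sigma_alt; rewrite hj mulrACA -expr2 -exprM mulnC exprM sqrrN.
by rewrite !expr1n mul1r; case: h0 => ->; rewrite ?mulrNN mulr1.
Qed.

Lemma sigmaS (j k : 'I_m.+1) : k = j.+1 :> nat -> sigma k = - sigma j.
Proof.
by have [_ hj] := sigma_alt; move=> kE; rewrite (hj k) (hj j) kE exprS mulN1r mulNr.
Qed.

Lemma alpha_slopeE : (0 < m)%N -> (alpha / slope : R) = m%:R / (m%:R + 1 / 2).
Proof.
move=> m0; have : 0 < (m%:R : R) by rewrite ltr0n.
rewrite /alpha /slope => mp; field.
by apply/andP; split; apply: lt0r_neq0; lra.
Qed.

Lemma alpha_slope_itv : (0 < m)%N -> 0 < (alpha / slope : R) < 1.
Proof.
move=> m0; rewrite alpha_slopeE//.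
have mp : 0 < (m%:R : R) by rewrite ltr0n.
by rewrite divr_gt0 ?ltr_pdivrMr; lra.
Qed.

Lemma slope_gt0 : 0 < (slope : R).
Proof. by have := ler0n R m; rewrite /slope; lra. Qed.

Lemma sawtooth_overlap (j k : 'I_m.+1) y : (j < k)%N ->
  `|y - Ihat j| <= 1 -> `|y - Ihat k| <= 1 ->
  sigma j * slope * (y - Ihat j) = sigma k * slope * (y - Ihat k).
Proof.
move=> jk; rewrite !ler_norml /Ihat => hj hk.
have kE : k = j.+1 :> nat.
  apply/eqP; rewrite eqn_leq jk andbT leqNgt; apply/negP => jk2.
  have : ((j.+2)%:R : R) <= k%:R by rewrite ler_nat.
  by rewrite -!natr1; lra.
rewrite (sigmaS kE); move: hk; rewrite kE -natr1 => hk.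
have -> : y = 2 * j%:R - m%:R + 1 by lra.
by ring.
Qed.

Lemma sawtoothE j y : `|y - Ihat j| <= 1 ->
  sawtooth y = sigma j * slope * (y - Ihat j).
Proof.
move=> hj; rewrite /sawtooth; case: pickP => [k hk|/(_ j)]; last by rewrite hj.
case: (ltngtP j k) => [jk|kj|/ord_inj -> //].
- by rewrite (sawtooth_overlap jk hj hk).
- by rewrite (sawtooth_overlap kj hk hj).
Qed.

Lemma plateau_widthE p i :
  1 + sigma (lift ord0 i) * plateau_value p i / slope =
  1 - (2 * p ord0 i - 1) * (alpha / slope).
Proof.
rewrite /plateau_value; congr (_ + _).
transitivity (- (sigma (lift ord0 i) * sigma (lift ord0 i)) *
              (2 * p ord0 i - 1) * (alpha / slope)); first by ring.
by rewrite sigma_sqr; ring.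
Qed.

Lemma plateau_overlap p (i k : 'I_m) y : Pm p -> (i < k)%N ->
  in_plateau p y i -> in_plateau p y k ->
  plateau_value p i = plateau_value p k.
Proof.
move=> [p01 pS] ik; rewrite /in_plateau !plateau_widthE /Chat.
have /andP[] := alpha_slope_itv (leq_ltn_trans (leq0n _) (ltn_ord i)).
rewrite !ler_norml; set a := _ / _ => a0 a1 hi hk.
have pi := p01 i; have pk := p01 k.
have kE : k = i.+1 :> nat.
  apply/eqP; rewrite eqn_leq ik andbT leqNgt; apply/negP => ik2.
  have : ((i.+2)%:R : R) <= k%:R by rewrite ler_nat.
  move: hi hk; rewrite -!natr1 => hi hk ikR.
  suff : (2 - 2 * p ord0 i - 2 * p ord0 k) * a < 2 by lra.
  by nra.
have p1 : 1 <= p ord0 i + p ord0 k by exact: pS.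
move: hi hk; rewrite kE -!natr1 => hi hk.
have : (p ord0 i + p ord0 k - 1) * a <= 0 by lra.
rewrite pmulr_lle0// => p2.
rewrite /plateau_value (@sigmaS (lift ord0 i) (lift ord0 k)) ?lift0 ?kE//.
have -> : p ord0 k = 1 - p ord0 i by lra.
by ring.
Qed.

Lemma stunted_sawtooth_plateau p i y : Pm p -> in_plateau p y i ->
  stunted_sawtooth p y = plateau_value p i.
Proof.
move=> Pp hi; rewrite /stunted_sawtooth.
case: pickP => [k hk|/(_ i)]; last by rewrite hi.
case: (ltngtP i k) => [ik|ki|/ord_inj -> //].
- by rewrite (plateau_overlap Pp ik hi hk).
- by rewrite (plateau_overlap Pp ki hk hi).
Qed.

Lemma stunted_sawtooth_off p y : (forall i, ~~ in_plateau p y i) ->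
  stunted_sawtooth p y = sawtooth y.
Proof.
rewrite /stunted_sawtooth => off; case: pickP => // i.
by rewrite (negbTE (off i)).
Qed.

Lemma sigma_norm j : `|sigma j| = 1.
Proof.
apply/eqP; rewrite -(@eqrXn2 _ 2) ?normr_ge0// -normrX expr2 sigma_sqr.
by rewrite normr1 expr1n.
Qed.

Lemma alphaE : (0 < m)%N -> (alpha : R) = m%:R + alpha / slope.
Proof.
move=> m0; have : 0 < (m%:R : R) by rewrite ltr0n.
rewrite /alpha /slope => mp; field.
by apply/andP; split; apply: lt0r_neq0; lra.
Qed.

Lemma J_cover y : (0 < m)%N -> J y -> exists j, `|y - Ihat j| <= 1.
Proof.
move=> m0; have /andP[a0 a1] := alpha_slope_itv m0.
rewrite /J /= in_itv /= (alphaE m0); move: a0 a1; set a := _ / _ => a0 a1 yJ.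
have /truncn_itv : 0 <= (y + m%:R + 1) / 2 by lra.
set k := Num.truncn _; rewrite -(natr1 k) => kE.
have km : (k < m.+1)%N by rewrite -(@ltr_nat R) -(natr1 m); lra.
by exists (Ordinal km); rewrite /Ihat /= ler_norml; lra.
Qed.

Lemma stunted_sawtooth_J p y : (0 < m)%N -> Pm p -> J y ->
  J (stunted_sawtooth p y).
Proof.
move=> m0 [p01 pS] yJ; have /andP[a0 a1] := alpha_slope_itv m0.
have s0 := slope_gt0.
have alpha0 : 0 < (alpha : R).
  by rewrite (alphaE m0) ltr_wpDl ?ler0n.
rewrite {1}/J /= in_itv /= -ler_norml /stunted_sawtooth.
case: pickP => [i _|off].
  rewrite /plateau_value normrM normrM sigma_norm mulr1 (gtr0_norm alpha0).
  rewrite ler_piMl ?(ltW alpha0)// ler_norml.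
  by have := p01 i; lra.
have [j hj] := J_cover m0 yJ.
rewrite (sawtoothE hj) !normrM sigma_norm mul1r (gtr0_norm s0).
rewrite mulrC -ler_pdivlMr//.
rewrite /J /= in_itv /= (alphaE m0) in yJ.
move: yJ off a0 a1; rewrite /in_plateau => yJ off.
have {}off i : 1 - (2 * p ord0 i - 1) * (alpha / slope) < `|y - Chat i|.
  by rewrite -plateau_widthE ltNge off.
move: yJ off; set a := alpha / slope => yJ off a0 a1.
have {}off i : 1 - a < `|y - Chat i|.
  apply: le_lt_trans (off i); rewrite lerD2l lerN2 ler_piMl ?(ltW a0)//.
  by have := p01 i; lra.
move: hj; rewrite !ler_norml => hj; apply/andP; split.
- have [j0|j0] := posnP j; first by rewrite /Ihat j0; lra.
  have jm : (j.-1 < m)%N by rewrite prednK// -ltnS.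
  have := off (Ordinal jm); rewrite /Chat /= prednK//.
  move: hj; rewrite /Ihat => hj.
  by rewrite ger0_norm; lra.
- have [jm|] := ltnP j m; last first.
    rewrite leq_eqVlt ltnNge -ltnS ltn_ord orbF => /eqP jm.
    by rewrite /Ihat -jm; lra.
  have := off (Ordinal jm); rewrite /Chat /= -(natr1 j).
  move: hj; rewrite /Ihat => hj.
  by rewrite ler0_norm; lra.
Qed.

End StuntedSawtooth.

Arguments Pm R m : clear implicits.
Arguments J R m : clear implicits.

(* Main.v *)
(* Write u_j = 2 p_j - 1 and u_0 = u_(m+1) = 1. The orbits of S_p that avoid the
   plateaus are coded by words in the laps 0, ..., m, and S_p expands along
   them by the constant factor s; once two orbits meet the same plateau they
   coincide. Hence h(S_p) is the exponential growth rate of the number of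
   admissible words. This rate is monotone in p, upper semicontinuous because
   the number of words is submultiplicative, and lower semicontinuous because
   a growth rate larger than 1 is carried by horseshoes, which survive small
   perturbations. Moreover clamping p to [t/2, 1 - t/2] restricts the values of
   the map to [-(1-t) alpha, (1-t) alpha] up to transient outer orbits, so it does
   not increase the entropy.
   Therefore t |-> clamp_t p contracts the isentrope inside {h <= h0} to the
   point (1/2, ..., 1/2). The flow p |-> min(p + t, 1), being a uniform
   translation of a monotone function, reaches {h >= h0} after a time that is
   1-Lipschitz in p; stopping it there retracts {h <= h0} onto the isentrope. *)

Require Import Defs.
From mathcomp Require Import all_boot all_order all_algebra.
From mathcomp Require Import finmap.
From mathcomp Require Import all_classical all_reals all_analysis.
From mathcomp Require Import ring lra zify.

Set Implicit Arguments.
Unset Strict Implicit.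
Unset Printing Implicit Defensive.

Import Order.TTheory GRing.Theory Num.Theory.
Import numFieldNormedType.Exports.

Local Open Scope classical_set_scope.
Local Open Scope ring_scope.

(** * Words and growth rates *)

Section Words.
Context {T : eqType}.
Implicit Types (bs : seq T) (F : seq T -> nat).

(** The two semicontinuities are of different nature. From above, a bound at one length n already
    bounds the rate, and only finitely many words have that length. From below no finite count is
    enough, since an admissible word need not be repeatable; this forces the horseshoe. The
    cylinders of the words of length N are disjoint intervals, and the end points that follow a
    given word form an interval, which therefore covers all the cylinders it meets except at most
    the two outermost. The loss of two blocks per step is outweighed when N is so large that t^N > 2
    for a rate t > 1, and the covered cylinders have a margin that pays for a decrease of the
    parameter. Clamping needs an argument because it raises the coordinates below t/2 and so admits
    new words. Inside [-(1-t) alpha, (1-t) alpha], however, a transition forbidden before clamping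
    must land on one of the two end points, so the rest of its word is the itinerary of one of two
    fixed points. The number of words grows at most by a factor linear in n and a summation over
    shorter lengths, which leave the exponential rate unchanged. *)

Fixpoint words bs n : seq (seq T) :=
  if n is n'.+1 then [seq a :: w | a <- bs, w <- words bs n'] else [:: [::]].

Lemma mem_words bs n w :
  (w \in words bs n) = (size w == n) && all (mem bs) w.
Proof.
elim: n w => [|n IH] [|a w] //=.
  by apply/allpairsPdep => -[? [? []]].
rewrite eqSS; apply/allpairsPdep/idP => [[b [x [bb]]]|/and3P[sw ab aw]].
  by rewrite IH => /andP[sx ax] [-> ->]; rewrite sx ax bb.
by exists a, w; rewrite IH sw aw.
Qed.

Lemma words_uniq bs n : uniq bs -> uniq (words bs n).
Proof.
move=> ub; elim: n => //= n IH; rewrite allpairs_uniq //.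
by move=> [a w] [b x] _ _ /= [-> ->].
Qed.

Lemma size_words bs n : size (words bs n) = (size bs ^ n)%N.
Proof. by elim: n => //= n IH; rewrite size_allpairs IH expnS. Qed.

Lemma sum_wordsS bs n F :
  (\sum_(w <- words bs n.+1) F w = \sum_(a <- bs) \sum_(w <- words bs n) F (a :: w))%N.
Proof. exact: big_allpairs_dep. Qed.

Lemma sum_words_cat bs n k F :
  (\sum_(w <- words bs (n + k)) F w =
   \sum_(x <- words bs n) \sum_(y <- words bs k) F (x ++ y))%N.
Proof.
elim: n F => [|n IH] F; first by rewrite big_seq1.
by rewrite addSn !sum_wordsS; apply: eq_bigr => a _; rewrite IH.
Qed.

Lemma sum_words1 bs F : (\sum_(w <- words bs 1) F w = \sum_(a <- bs) F [:: a])%N.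
Proof. by rewrite sum_wordsS; apply: eq_bigr => a _; rewrite big_seq1. Qed.

Lemma sum_words_rcons bs n F :
  (\sum_(w <- words bs n.+1) F w =
   \sum_(x <- words bs n) \sum_(b <- bs) F (rcons x b))%N.
Proof.
rewrite -addn1 sum_words_cat; apply: eq_bigr => x _.
by rewrite sum_words1; apply: eq_bigr => b _; rewrite cats1.
Qed.

Lemma leq_sum_filter (I : Type) (P : pred I) (s : seq I) (G : I -> nat) :
  (\sum_(i <- [seq i <- s | P i]) G i <= \sum_(i <- s) G i)%N.
Proof. by rewrite big_filter [leqRHS](bigID P) /= leq_addr. Qed.

Lemma sum_words_filter (P : pred T) bs n F :
  (\sum_(w <- words [seq b <- bs | P b] n) F w <= \sum_(w <- words bs n) F w)%N.
Proof.
elim: n F => // n IH F; rewrite !sum_wordsS.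
apply: leq_trans (leq_sum_filter P _ _); apply: leq_sum => a _; exact: IH.
Qed.

Lemma leq_sum_mem bs (G : T -> nat) b :
  b \in bs -> (G b <= \sum_(c <- bs) G c)%N.
Proof. by move=> /perm_to_rem/(perm_big _) ->; rewrite big_cons leq_addr. Qed.

End Words.

(** Regroups letters into blocks of length N, so that [horseshoe] can be applied with blocks as its
    alphabet. *)
Lemma sum_words_flatten (T : eqType) (bs : seq T) N k (F : seq T -> nat) :
  (\sum_(W <- words (words bs N) k) F (flatten W) =
   \sum_(w <- words bs (k * N)) F w)%N.
Proof.
elim: k F => [|k IH] F; first by rewrite !big_seq1.
rewrite sum_wordsS mulSn sum_words_cat; apply: eq_bigr => b _.
exact: (IH (fun w => F (b ++ w))).
Qed.

Section Growth.
Context {R : realType}.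
Implicit Types (a b : nat -> nat) (x y : R).

(** A one-sided bound instead of a limit: comparisons that lose a linear factor or a sum over
    lengths become implications from [grow] at x to [grow] at any y > x. *)
Definition grow a x := exists C : R, forall n, (a n)%:R <= C * x ^+ n.

Lemma grow_le a b x : (forall n, (a n <= b n)%N) -> grow b x -> grow a x.
Proof. by move=> ab [C HC]; exists C => n; apply: le_trans (HC n); rewrite ler_nat. Qed.

Lemma growW a x : 0 < x -> grow a x ->
  exists2 C : R, 0 < C & forall n, (a n)%:R <= C * x ^+ n.
Proof.
move=> x0 [C HC]; exists (Num.max C 1); first by rewrite lt_max ltr01 orbT.
move=> n; apply: le_trans (HC n) _.
by rewrite ler_pM2r ?exprn_gt0// le_max lexx.
Qed.

Lemma grow_mono a x y : 0 < x -> x <= y -> grow a x -> grow a y.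
Proof.
move=> x0 xy /(growW x0)[C C0 HC]; exists C => n; apply: le_trans (HC n) _.
by rewrite ler_pM2l// lerXn2r// nnegrE ltW// (lt_le_trans x0).
Qed.

(** Bernoulli's inequality for y/x = 1 + d; the constant comes from (1 + 1/d)(1 + d n) >= n + 1. *)
Lemma linear_le_exp (x y : R) : 0 < x -> x < y ->
  exists2 D : R, 0 < D & forall n, n.+1%:R * x ^+ n <= D * y ^+ n.
Proof.
move=> x0 xy; set d := y / x - 1.
have d0 : 0 < d by rewrite /d subr_gt0 ltr_pdivlMr// mul1r.
exists (1 + d^-1) => [|n]; first by rewrite addr_gt0 ?invr_gt0.
have -> : y = (1 + d) * x by rewrite /d addrC subrK divfK// gt_eqF.
rewrite exprMn mulrA ler_pM2r ?exprn_gt0//.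
have h : 1 + d * n%:R <= (1 + d) ^+ n.
  elim: n => [|n IH]; first by rewrite mulr0 addr0 expr0.
  rewrite exprS; apply: le_trans (ler_pM _ _ (lexx (1 + d)) IH); first last.
  - by rewrite addr_ge0// mulr_ge0// ltW.
  - by rewrite addr_ge0// ltW.
  rewrite -natr1; have : 0 <= d * (d * n%:R) by rewrite !mulr_ge0// ltW.
  lra.
apply: le_trans (ler_wpM2l _ h); last by rewrite addr_ge0// invr_ge0 ltW.
rewrite -natr1 mulrDl mul1r mulrDr mulr1 mulrA mulVf ?gt_eqF// mul1r.
have : 0 <= d * n%:R by rewrite mulr_ge0// ltW.
have : 0 < d^-1 by rewrite invr_gt0.
lra.
Qed.

Lemma grow_linear a b x y (c : nat) : 0 < x -> x < y ->
  (forall n, (b n <= c * (n.+1 * a n))%N) -> grow a x -> grow b y.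
Proof.
move=> x0 xy ba /(growW x0)[C C0 HC]; have [D D0 HD] := linear_le_exp x0 xy.
exists (c%:R * (C * D)) => n.
have : ((b n)%:R : R) <= (c * (n.+1 * a n))%:R by rewrite ler_nat.
move=> /le_trans; apply; rewrite natrM -mulrA ler_wpM2l// natrM -mulrA.
apply: le_trans (ler_wpM2l (ltW C0) (HD n)).
by rewrite mulrCA ler_wpM2l.
Qed.

Lemma grow_sum a x y : 1 <= x -> x < y -> grow a x ->
  grow (fun n => \sum_(k < n.+1) a k)%N y.
Proof.
move=> x1 xy ga; have x0 : 0 < x by apply: lt_le_trans x1.
have [C C0 HC] := growW x0 ga; have [D D0 HD] := linear_le_exp x0 xy.
exists (C * D) => n; rewrite natr_sum -mulrA.
apply: le_trans (ler_wpM2l (ltW C0) (HD n)).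
apply: (@le_trans _ _ (\sum_(k < n.+1) C * x ^+ n)).
  apply: ler_sum => k _; apply: le_trans (HC k) _.
  by rewrite ler_pM2l// ler_weXn2l// -ltnS.
by rewrite sumr_const card_ord -(mulr_natl (_ * _)) mulrCA.
Qed.

(** Fekete's argument: divide the length by n and put the finitely many remainders into the
    constant. A single inequality thus controls the rate, which is what makes the rate upper
    semicontinuous. *)
Lemma grow_submul a x n : (0 < n)%N -> 0 < x ->
  (forall i j, (a (i + j) <= a i * a j)%N) -> (a n)%:R <= x ^+ n -> grow a x.
Proof.
move=> n0 x0 sub an.
exists (\sum_(r < n) (a r)%:R / x ^+ r) => k.
rewrite (divn_eq k n); set q := (k %/ n)%N; set r := (k %% n)%N.
have rn : (r < n)%N by rewrite ltn_mod.
have aq : (a (q * n + r) <= a n ^ q * a r)%N.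
  elim: q => [|q IH]; first by rewrite expn0 mul1n.
  by rewrite mulSn -addnA (leq_trans (sub _ _))// expnS -mulnA leq_mul2l IH orbT.
have h : (a n ^ q * a r)%:R <= x ^+ (q * n) * (a r)%:R.
  rewrite natrM natrX ler_wpM2r// mulnC exprM.
  by apply: lerXn2r => //; rewrite nnegrE ?exprn_ge0 ?ler0n// ltW.
have aqR : (a (q * n + r))%:R <= (a n ^ q * a r)%:R :> R by rewrite ler_nat.
apply: le_trans (le_trans aqR h) _.
rewrite (bigD1 (Ordinal rn))//= mulrDl exprD mulrCA.
have -> : x ^+ (q * n) * ((a r)%:R / x ^+ r * x ^+ r) = x ^+ (q * n) * (a r)%:R.
  by rewrite divfK// expf_neq0// gt_eqF.
rewrite lerDl mulr_ge0 ?sumr_ge0// => [i _|].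
  by rewrite divr_ge0// exprn_ge0// ltW.
by rewrite mulr_ge0// exprn_ge0// ltW.
Qed.

Lemma sum_geometric_le (x y : R) n : 0 < x -> x < y ->
  \sum_(k < n) x ^+ k * y ^+ (n - k.+1) <= (y - x)^-1 * y ^+ n.
Proof.
move=> x0 xy; rewrite ler_pdivlMl ?subr_gt0//.
have -> : \sum_(k < n) x ^+ k * y ^+ (n - k.+1) =
          \sum_(k < n) y ^+ (n.-1 - k) * x ^+ k.
  by apply: eq_bigr => k _; rewrite mulrC; congr (y ^+ _ * _); lia.
by rewrite -subrXX lerBlDr lerDl exprn_ge0// ltW.
Qed.

End Growth.

(** Descent on the number of successors: by transitivity a successor b of a has no successors that a
    lacks, and it loses b itself when [r b b] fails. *)
Lemma transitive_reflexive_point (T : eqType) (s : seq T) (r : rel T) :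
  s != [::] -> (forall a b c, r a b -> r b c -> r a c) ->
  (forall a, a \in s -> exists2 b, b \in s & r a b) ->
  exists2 a, a \in s & r a a.
Proof.
move=> s0 tr ex; pose d a := count (r a) s.
have [a as_ _] : exists2 a, a \in s & true.
  by case: s s0 {ex d} => // a s _; exists a; rewrite ?mem_head.
have [n dn] := ubnP (d a); elim: n a as_ dn => // n IH a as_ dn.
have [b bs rab] := ex a as_; have [raa|naa] := boolP (r b b); first by exists b.
apply: (IH b bs); rewrite -ltnS; apply: leq_trans dn; rewrite ltnS /d.
have sub : subpred (predU (pred1 b) (r b)) (r a).
  by move=> c /orP[/eqP ->//|]; exact: tr.
apply: leq_trans (sub_count sub s).
rewrite -[leqRHS]addn0 -(_ : count (predI (pred1 b) (r b)) s = 0%N); last first.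
  by rewrite -(count_pred0 s); apply: eq_count => c /=; case: eqP => //= ->; exact/negbTE.
rewrite count_predUI -add1n leq_add2r -has_count; apply/hasP.
by exists b => //=.
Qed.

(* Abstract form of the Misiurewicz-Szlenk argument: [cov w b] says that the
   set of points following [w] contains all points that can start with [b].
   When at most two letters can follow a given word without being covered, and
   the number of admissible words grows faster than any rate 2 < x, some letter
   is covered by at least x^n words of some length n that start with it. *)
Section Horseshoe.
Context {R : realType} {T : eqType}.
Variables (bs : seq T) (adm : pred (seq T)) (cov : seq T -> T -> bool).
Hypothesis adm_catl : forall w x, adm (w ++ x) -> adm w.
Hypothesis adm_catr : forall w x, adm (w ++ x) -> adm x.
Hypothesis few_uncovered : forall w, w != [::] ->
  (\sum_(b <- bs) (adm (rcons w b) && ~~ cov w b) <= 2)%N.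
Hypothesis cov_trans : forall w b x c,
  cov w b -> cov (b :: x) c -> cov (w ++ b :: x) c.

Let total w n : nat := (\sum_(x <- words bs n) adm (w ++ x))%N.
Let inside (E : pred T) w n : nat :=
  (\sum_(x <- words [seq b <- bs | E b] n) adm (w ++ x))%N.
Let outside (E : pred T) n : nat :=
  (\sum_(b <- bs | ~~ E b) total [:: b] n)%N.
Let covering a b n : nat := (\sum_(x <- words bs n) cov (a :: x) b)%N.

(** Cut the word at its first letter outside [E], at position k; admissibility passes to both
    pieces. *)
Let total_le E w n : (total w n <=
  inside E w n + \sum_(k < n) inside E w k * outside E (n - k.+1))%N.
Proof.
elim: n w => [|n IH] w; first by rewrite /total /inside !big_seq1 big_ord0 addn0.
rewrite {1}/total sum_wordsS (bigID E) /= -big_filter.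
have step b : (\sum_(x <- words bs n) adm (w ++ b :: x) = total (rcons w b) n)%N.
  by apply: eq_bigr => x _; rewrite cat_rcons.
have hin k : (\sum_(b <- [seq b <- bs | E b]) inside E (rcons w b) k = inside E w k.+1)%N.
  rewrite /inside sum_wordsS; apply: eq_bigr => b _; apply: eq_bigr => x _.
  by rewrite cat_rcons.
have h1 : (\sum_(b <- [seq b <- bs | E b]) \sum_(x <- words bs n) adm (w ++ b :: x) <=
  inside E w n.+1 + \sum_(k < n) inside E w k.+1 * outside E (n - k.+1))%N.
  rewrite -hin (eq_bigr (fun k : 'I_n => \sum_(b <- [seq b <- bs | E b])
    inside E (rcons w b) k * outside E (n - k.+1))%N); last first.
    by move=> k _; rewrite -hin big_distrl.
  rewrite [X in (_ + X)%N]exchange_big -big_split /=; apply: leq_sum => b _.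
  by rewrite step; exact: IH.
have h2 : (\sum_(b <- bs | ~~ E b) \sum_(x <- words bs n) adm (w ++ b :: x) <=
  inside E w 0 * outside E n)%N.
  rewrite {1}/inside /= big_seq1 cats0 /outside.
  case: (boolP (adm w)) => [_|nw]; last first.
    rewrite mul0n leqn0; apply/eqP; apply: big1 => b _; apply: big1 => x _.
    by apply/eqP; rewrite eqb0; apply: contra nw; exact: adm_catl.
  rewrite mul1n; apply: leq_sum => b _; apply: leq_sum => x _ /=.
  by case: (boolP (adm (w ++ _))) => // /adm_catr ->.
rewrite big_ord_recl subn1 /=; apply: leq_trans (leq_add h1 h2) _.
rewrite -addnA leq_add2l addnC leq_add2l //.
Qed.

(** Of the letters that may be appended to a given word at most two are not covered; this is the
    factor 2 that the rate has to beat. *)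
Let inside_step E a n : (inside E [:: a] n.+1 <=
  2 * inside E [:: a] n + \sum_(b <- [seq b <- bs | E b]) covering a b n)%N.
Proof.
rewrite /inside sum_words_rcons.
have h b : (\sum_(x <- words [seq b <- bs | E b] n) cov (a :: x) b <= covering a b n)%N.
  exact: (sum_words_filter E bs n (fun x => nat_of_bool (cov (a :: x) b))).
apply: (@leq_trans (2 * (\sum_(x <- words [seq b <- bs | E b] n) adm (a :: x)) +
  \sum_(b <- [seq b <- bs | E b])
    \sum_(x <- words [seq b <- bs | E b] n) cov (a :: x) b)%N); last first.
  by rewrite leq_add2l; apply: leq_sum => b _; exact: h.
rewrite [X in (_ + X)%N]exchange_big /= big_distrr -big_split /=; apply: leq_sum => x _.
apply: (@leq_trans (\sum_(b <- [seq b <- bs | E b])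
   ((adm (rcons (a :: x) b) && ~~ cov (a :: x) b) + cov (a :: x) b))%N).
  apply: leq_sum => b _; rewrite -rcons_cons.
  by case: (adm _); case: (cov _ _).
rewrite big_split leq_add2r /=.
case: (boolP (adm (a :: x))) => [_|nax]; last first.
  rewrite muln0 leqn0; apply/eqP; apply: big1 => b _; apply/eqP; rewrite eqb0.
  by rewrite -rcons_cons -cats1; apply: contra nax => /andP[/adm_catl].
rewrite muln1; apply: leq_trans (few_uncovered (w := a :: x) isT).
exact: leq_sum_filter.
Qed.

Let covering_trans a b c n k : b \in bs ->
  (covering a b n * covering b c k <= covering a c (n + k.+1))%N.
Proof.
move=> bbs; rewrite /covering sum_words_cat big_distrl /=.
apply: leq_sum => x _; rewrite sum_wordsS.
apply: leq_trans (leq_sum_mem (fun b' => \sum_(w <- words bs k)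
   cov (a :: x ++ b' :: w) c)%N bbs).
rewrite big_distrr; apply: leq_sum => y _ /=.
case: (boolP (cov (a :: x) b)) => //= h1; case: (boolP (cov (b :: y) c)) => //= h2.
by rewrite -cat_cons (cov_trans h1 h2).
Qed.

Lemma horseshoe (x y : R) : 2 < x -> x < y ->
  ~ grow (fun n => \sum_(w <- words bs n) adm w)%N y ->
  exists2 b, b \in bs &
    exists n, x ^+ n.+1 <= (\sum_(w <- words bs n) cov (b :: w) b)%:R.
Proof.
move=> x2 xy ng; have x0 : 0 < x by apply: lt_trans x2.
have y0 : 0 < y by apply: lt_trans xy.
pose E a := `[< ~ grow (total [:: a]) y >].
(* The exponent [n.+1] counts the initial letter [a] too, so exponents add under concatenation and
   [r] is transitive. [E] collects the letters after which words grow faster than y. *)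
pose r a b := (a \in bs) && (b \in bs) && `[< exists n, x ^+ n.+1 <= (covering a b n)%:R >].
suff [b] : exists2 b, b \in [seq b <- bs | E b] & r b b.
  by rewrite mem_filter => /andP[_ bb] /andP[_ /asboolP h]; exists b.
have outE : exists2 C : R, 0 < C & forall n, (outside E n)%:R <= C * y ^+ n.
  apply: (growW (a := outside E)) => //.
  suff gs s : grow (fun n => \sum_(b <- s | ~~ E b) total [:: b] n)%N y by exact: gs.
  elim: s => [|b s [C IH]].
    by exists 0 => n; rewrite big_nil mul0r.
  case: (boolP (E b)) => Eb.
    by exists C => n; rewrite big_cons Eb /=.
  have [C' HC'] : grow (total [:: b]) y by move/asboolPn: Eb => /contrapT.
  exists (C' + C) => n; rewrite big_cons Eb natrD mulrDl.
  by apply: lerD.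
(* If the words staying in [E] grew at most like x^n, cutting at the first exit from [E] would bound
   all words after [a] by a convolution of x^k and y^(n-k-1), of order y^n because x < y. *)
have insE a : a \in [seq b <- bs | E b] -> ~ grow (inside E [:: a]) x.
  rewrite mem_filter => /andP[/asboolP nga _] gi; apply: nga.
  have [C C0 HC] := growW x0 gi; have [D D0 HD] := outE.
  exists (C + C * D * (y - x)^-1) => n.
  have tl : (total [:: a] n)%:R <= (inside E [:: a] n +
     \sum_(k < n) inside E [:: a] k * outside E (n - k.+1))%N%:R :> R.
    by rewrite ler_nat total_le.
  apply: (le_trans tl); rewrite natrD mulrDl; apply: lerD.
    apply: le_trans (HC n) _; rewrite ler_pM2l// lerXn2r ?nnegrE//; exact: ltW.
  rewrite -[leRHS]mulrA; apply: le_trans (ler_wpM2l _ (sum_geometric_le n x0 xy)); last first.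
    by rewrite mulr_ge0// ltW.
  rewrite natr_sum mulr_sumr; apply: ler_sum => k _.
  by rewrite natrM mulrACA ler_pM.
have nE : [seq b <- bs | E b] != [::].
  apply: contra_notN ng => /eqP E0.
  have [D D0 HD] := outE; exists (D / y + 1) => -[|n].
    rewrite big_seq1 expr0 mulr1.
    apply: (@le_trans _ _ 1); first by rewrite lern1 leq_b1.
    by rewrite lerDr divr_ge0// ltW.
  rewrite sum_wordsS.
  apply: (@le_trans _ _ (outside E n)%:R).
    rewrite ler_nat (bigID E) /= -big_filter E0 big_nil add0n leqnn //.
  apply: le_trans (HD n) _; rewrite mulrDl mul1r exprS mulrA divfK ?gt_eqF//.
  by rewrite lerDl -exprS exprn_ge0// ltW.
apply: transitive_reflexive_point => //.
  move=> a b c /andP[/andP[aa bb] /asboolP[n hn]] /andP[/andP[_ cc] /asboolP[k hk]].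
  apply/andP; split; first by rewrite aa.
  apply/asboolP; exists (n + k.+1)%N.
  apply: (@le_trans _ _ (covering a b n * covering b c k)%:R); last first.
    by rewrite ler_nat covering_trans.
  rewrite natrM -addSn exprD; apply: ler_pM => //; rewrite exprn_ge0// ltW//.
(* Without a successor of [a] in [E], every covering count from [a] into [E] is below x^(n+1), and
   [inside_step] becomes a linear recursion of rate at most x, against [insE]. *)
move=> a aE; apply: contrapT => hno; apply: (insE a aE).
have abs : a \in bs by move: aE; rewrite mem_filter => /andP[].
have small b : b \in [seq b <- bs | E b] -> forall n, (covering a b n)%:R <= x ^+ n.+1.
  move=> bE n; rewrite leNgt; apply/negP => h; apply: hno; exists b => //.
  rewrite /r abs /=; move: (bE); rewrite mem_filter => /andP[_ ->] /=.
  by apply/asboolP; exists n; exact: ltW.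
set q := size [seq b <- bs | E b].
(* The constant e = q x / (x - 2) solves 2 e + q x = e x, the recursion for e x^n. *)
exists (1 + q%:R * x / (x - 2)); elim=> [|n IH].
  rewrite /inside big_seq1 expr0 mulr1.
  apply: (@le_trans _ _ 1); first by rewrite lern1 leq_b1.
  by rewrite lerDl divr_ge0 ?subr_ge0 ?ltW// mulr_gt0// ltr0n /q lt0n size_eq0.
have il : (inside E [:: a] n.+1)%:R <= (2 * inside E [:: a] n +
  \sum_(b <- [seq b <- bs | E b]) covering a b n)%N%:R :> R.
  by rewrite ler_nat inside_step.
apply: (le_trans il); rewrite natrD natrM.
have h : (\sum_(b <- [seq b <- bs | E b]) covering a b n)%:R <= q%:R * x ^+ n.+1.
  apply: (@le_trans _ _ (\sum_(b <- [seq b <- bs | E b]) x ^+ n.+1)).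
    rewrite natr_sum [leLHS]big_seq [leRHS]big_seq.
    by apply: ler_sum => b bE; exact: small.
  by rewrite big_const_seq count_predT iter_addr_0 mulr_natl.
apply: le_trans (lerD (ler_wpM2l _ IH) h) _ => //.
rewrite exprS; set e := q%:R * x / (x - 2); set X := x ^+ n.
have X0 : 0 < X by rewrite exprn_gt0.
have -> : q%:R * (x * X) = e * (x - 2) * X.
  by rewrite divfK ?mulrA// subr_eq0 gt_eqF.
have : 0 <= (x - 2) * X by rewrite mulr_ge0 ?subr_ge0 ?ltW.
by move=> hX; lra.
Qed.

End Horseshoe.

(** * Itineraries of the stunted sawtooth maps *)

Lemma common_delta (R : realType) (T : eqType) (l : seq T) (P : T -> R -> Prop) :
  (forall t d d', P t d -> 0 < d' -> d' <= d -> P t d') ->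
  (forall t, t \in l -> exists2 d, 0 < d & P t d) ->
  exists2 d, 0 < d & forall t, t \in l -> P t d.
Proof.
move=> mono; elim: l => [_|t l IH ex]; first by exists 1.
have [d1 d10 P1] := ex t (mem_head _ _).
have [|d2 d20 P2] := IH; first by move=> t' t'l; apply: ex; rewrite inE t'l orbT.
have dd : 0 < Num.min d1 d2 by rewrite lt_min d10.
exists (Num.min d1 d2) => // t'; rewrite inE => /orP[/eqP ->|t'l].
  by apply: mono P1 dd _; rewrite ge_min lexx.
by apply: mono (P2 _ t'l) dd _; rewrite ge_min lexx orbT.
Qed.

Lemma sum_bool_le2 (T : eqType) (l : seq T) (P : pred T) : uniq l ->
  (forall x y z, P x -> P y -> P z -> x != y -> x != z -> y != z -> False) ->
  (\sum_(x <- l) P x <= 2)%N.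
Proof.
move=> ul no; rewrite -big_mkcond sum1_count -size_filter.
have := filter_uniq P ul; have : all P [seq x <- l | P x] by exact: filter_all.
case: [seq x <- l | P x] => [|x [|y [|z t]]] //= /and4P[px py pz _].
rewrite !inE !negb_or => /and4P[/and3P[xy xz _] /andP[yz _] _ _].
by case: (no x y z).
Qed.

Section Itineraries.
Context {R : realType} {m : nat}.
Variable sigma : 'I_m.+1 -> R.
Hypothesis m_gt0 : (0 < m)%N.
Hypothesis sigma_alt : alternating_signs sigma.

Local Notation s := (@slope R m).
Local Notation a := (@alpha R m).
Local Notation letters := (enum 'I_m.+1).

Lemma slope_alpha : [/\ 1 < s, 0 < a / s, a / s < 1, a = m%:R + a / s & 0 < a].
Proof.
have /andP[r0 r1] := @alpha_slope_itv R m m_gt0.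
have aE := @alphaE R m m_gt0.
have mR : 1 <= (m%:R : R) by rewrite ler1n.
split => //; first by rewrite /slope; lra.
by rewrite aE; lra.
Qed.

Lemma sigma_pm1 j : sigma j = 1 \/ sigma j = -1.
Proof.
have /eqP := sigma_sqr sigma_alt j; rewrite -expr2 sqrf_eq1.
by case/orP => /eqP ->; [left|right].
Qed.

Lemma Ihat_bounds (j : 'I_m.+1) : - m%:R <= (Ihat j : R) <= m%:R.
Proof.
have : (j%:R : R) <= m%:R by rewrite ler_nat -ltnS.
by have := ler0n R j; rewrite /Ihat => ? ?; apply/andP; split; lra.
Qed.

(* The inverse branch of the sawtooth map on lap j. *)
Definition branch (j : 'I_m.+1) (y : R) : R := Ihat j + sigma j * y / s.

(** Orbits are parametrized by their end point z: the inverse branches are defined on all of J,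
    contract, and do not depend on the parameter, which enters only through [ok]. *)
Definition pre (w : seq 'I_m.+1) (z : R) : R := foldr branch z w.

(* [ok u w z]: z = y_n ends an orbit y_0, ..., y_n such that y_k is in
   the lap w_k for k < n, each y_(k+1) lying between the two extremal values
   of lap w_k. The value at the j-th turning point is - u_j sigma_j alpha. *)
Fixpoint ok (u : nat -> R) (w : seq 'I_m.+1) (z : R) : bool :=
  if w is j :: w' then
    ok u w' z && (- u j * a <= sigma j * pre w' z <= u j.+1 * a)
  else `|z| <= a.

Lemma branchB j y y' : branch j y - branch j y' = sigma j / s * (y - y').
Proof. by rewrite /branch; ring. Qed.

Lemma branch_J j y : `|y| <= a -> `|branch j y - Ihat j| <= a / s.
Proof.
have [s1 _ _ _ _] := slope_alpha; have s0 : 0 < s by apply: lt_trans s1.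
rewrite /branch addrAC subrr add0r => ya.
by rewrite !normrM normfV (gtr0_norm s0) ler_pM2r ?invr_gt0// (sigma_norm sigma_alt) mul1r.
Qed.

Lemma branch_le j y : `|y| <= a -> `|branch j y| <= a.
Proof.
move=> /(branch_J j); have [_ _ _ aE _] := slope_alpha.
have := Ihat_bounds j; rewrite !ler_norml => /andP[? ?] /andP[? ?].
by apply/andP; split; lra.
Qed.

Lemma pre_le w z : `|z| <= a -> `|pre w z| <= a.
Proof. by move=> za; elim: w => //= j w; exact: branch_le. Qed.

Lemma pre_cat w x z : pre (w ++ x) z = pre w (pre x z).
Proof. by rewrite /pre foldr_cat. Qed.

Lemma ok_le u w z : ok u w z -> `|z| <= a.
Proof. by elim: w => //= j w IH /andP[/IH]. Qed.

Lemma ok_cat u w x z : ok u (w ++ x) z = ok u x z && ok u w (pre x z).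
Proof.
elim: w => [|j w IH] /=; last by rewrite IH pre_cat -!andbA.
case: (boolP (ok u x z)) => //= /ok_le/(pre_le x) h.
by rewrite h.
Qed.

Lemma pre_affine w : exists2 c, `|c| = s ^- size w &
  forall z z', pre w z - pre w z' = c * (z - z').
Proof.
have [s1 _ _ _ _] := slope_alpha; have s0 : 0 < s by apply: lt_trans s1.
elim: w => [|j w [c nc IH]] /=.
  by exists 1 => [|z z']; rewrite ?normr1 ?expr0 ?invr1// mul1r.
exists (sigma j / s * c) => [|z z'].
  rewrite !normrM nc normfV (gtr0_norm s0) (sigma_norm sigma_alt) mul1r.
  by rewrite exprS invfM.
by rewrite branchB IH mulrA.
Qed.

Lemma pre_norm w z z' : `|pre w z - pre w z'| = `|z - z'| / s ^+ size w.
Proof. by have [c nc ->] := pre_affine w; rewrite normrM nc mulrC. Qed.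

(** [pre w] is affine with slope of modulus s^-|w|, so a margin e at the end becomes e / s^|w| at
    the start; the two cases are the two orientations. *)
Lemma sigma_pre w j z1 z z2 e : 0 <= e -> z1 + e <= z <= z2 - e ->
  (sigma j * pre w z1 + e / s ^+ size w <= sigma j * pre w z /\
   sigma j * pre w z <= sigma j * pre w z2 - e / s ^+ size w) \/
  (sigma j * pre w z2 + e / s ^+ size w <= sigma j * pre w z /\
   sigma j * pre w z <= sigma j * pre w z1 - e / s ^+ size w).
Proof.
move=> e0 /andP[h1 h2]; have [c nc cE] := pre_affine w.
have F1 : sigma j * pre w z = sigma j * pre w z1 + sigma j * c * (z - z1).
  by rewrite -mulrA -cE; ring.
have F2 : sigma j * pre w z = sigma j * pre w z2 - sigma j * c * (z2 - z).
  by rewrite -mulrA -cE; ring.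
have d1 : e * `|c| <= `|c| * (z - z1) by rewrite mulrC ler_wpM2l//; lra.
have d2 : e * `|c| <= `|c| * (z2 - z) by rewrite mulrC ler_wpM2l//; lra.
rewrite -nc.
have [sg|sg] : sigma j * c = `|c| \/ sigma j * c = - `|c|.
  by case: (sigma_pm1 j) => ->; case: (ger0P c) => hc;
    rewrite ?mul1r ?mulN1r ?opprK; [left|right|right|left].
- by left; rewrite sg in F1 F2; split; lra.
- by right; rewrite sg in F1 F2; split; lra.
Qed.

Lemma ok_inside u u' w z1 z z2 e d : 0 <= e -> z1 + e <= z <= z2 - e ->
  (forall j, u j - d <= u' j) -> d * a <= e / s ^+ size w ->
  ok u w z1 -> ok u w z2 -> ok u' w z.
Proof.
have [s1 _ _ _ a0] := slope_alpha; have s0 : 0 < s by apply: lt_trans s1.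
move=> e0 hz hu; elim: w => [|j w IH] /=.
  by rewrite !ler_norml => _; move: hz; lra.
move=> hd /andP[ok1 /andP[l1 h1]] /andP[ok2 /andP[l2 h2]].
have hd' : d * a <= e / s ^+ size w.
  apply: le_trans hd _; rewrite ler_wpM2l// lef_pV2 ?posrE ?exprn_gt0//.
  by rewrite exprS ler_peMl ?exprn_ge0// ltW.
rewrite IH//=.
have uj k : (u k - d) * a <= u' k * a by rewrite ler_pM2r.
have := uj j; have := uj j.+1; rewrite !mulrBl => u1 u2.
by case: (sigma_pre w j e0 hz) => -[? ?]; apply/andP; split; lra.
Qed.

Lemma ok_convex u w z1 z z2 : z1 <= z <= z2 -> ok u w z1 -> ok u w z2 -> ok u w z.
Proof.
move=> hz; apply: (@ok_inside _ _ _ _ _ _ 0 0); rewrite ?addr0 ?subr0 ?mul0r//.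
by move=> j; rewrite subr0.
Qed.

Lemma ok_mono u u' w z : (forall j, u j <= u' j) -> ok u w z -> ok u' w z.
Proof.
move=> uu h; apply: (@ok_inside u u' w z z z 0 0) => //; rewrite ?addr0 ?subr0 ?lexx ?mul0r//.
by move=> j; rewrite subr0.
Qed.

Lemma ok_full w z : `|z| <= a -> ok (fun=> 1) w z.
Proof.
move=> za; elim: w => //= j w ->; rewrite mulN1r mul1r -ler_norml normrM.
by rewrite (sigma_norm sigma_alt) mul1r pre_le.
Qed.

(** The inverse branches map J into intervals of radius a / s < 1 around centres that are 2 apart;
    this is the distance between neighbouring ones. *)
Definition gap : R := 2 * (1 - a / s).

Lemma gap_gt0 : 0 < gap.
Proof. by have [_ _ ? _ _] := slope_alpha; rewrite /gap; lra. Qed.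

Lemma branch_gap j k y z : j != k -> `|y| <= a -> `|z| <= a ->
  gap <= `|branch j y - branch k z|.
Proof.
have h (i i' : 'I_m.+1) : (i < i')%N -> (Ihat i : R) + 2 <= Ihat i'.
  by rewrite -(@ler_nat R) -natr1 /Ihat; lra.
rewrite -val_eqE neq_ltn /gap => jk /(branch_J j); rewrite ler_norml => hy.
move=> /(branch_J k); rewrite ler_norml => hz.
case/orP: jk => /h hjk; last by apply: le_trans (ler_norm _); lra.
by rewrite distrC; apply: le_trans (ler_norm _); lra.
Qed.

(** At the first letter where the words differ the points lie in different laps. The bound at time 0
    serves as the margin of the horseshoe, the bound at time k shows that orbits are separated. *)
Lemma pre_gap w w' z z' : size w = size w' -> w != w' -> `|z| <= a -> `|z'| <= a ->
  gap / s ^+ size w <= `|pre w z - pre w' z'| /\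
  exists2 k, (k < size w)%N & gap <= `|pre (drop k w) z - pre (drop k w') z'|.
Proof.
have [s1 _ _ _ _] := slope_alpha; have s0 : 0 < s by apply: lt_trans s1.
elim: w w' => [|j w IH] [|k w'] //= [sw] jk za za'.
case: (eqVneq j k) jk => [<-|jk] jw.
  have ww : w != w' by apply: contraNneq jw => ->.
  have [h [l lw hl]] := IH w' sw ww za za'; split; last by exists l.+1.
  rewrite branchB normrM normrM (sigma_norm sigma_alt) mul1r normfV (gtr0_norm s0).
  by rewrite exprSr invfM mulrA mulrC ler_pM2l ?invr_gt0.
have h := branch_gap jk (pre_le w za) (pre_le w' za').
split; last by exists 0%N.
apply: le_trans h; rewrite ler_pdivrMr ?exprn_gt0// ler_peMr ?exprn_ege1 ?ltW//.
exact: gap_gt0.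
Qed.

Lemma pre_inj w w' z z' : size w = size w' -> `|z| <= a -> `|z'| <= a ->
  pre w z = pre w' z' -> w = w'.
Proof.
move=> sw za za' e; apply/eqP/negPn/negP => ww.
have [+ _] := pre_gap sw ww za za'; rewrite e subrr normr0 leNgt divr_gt0 ?gap_gt0//.
have [s1 _ _ _ _] := slope_alpha.
by rewrite exprn_gt0// (lt_trans _ s1).
Qed.

(** * Counting admissible words, and semicontinuity of the count *)

Definition adm u w := `[< exists z, ok u w z >].

Definition cnt u n : nat := (\sum_(w <- words letters n) adm u w)%N.

Lemma adm_catl u w x : adm u (w ++ x) -> adm u w.
Proof. by move=> /asboolP[z]; rewrite ok_cat => /andP[_ h]; apply/asboolP; exists (pre x z). Qed.

Lemma adm_catr u w x : adm u (w ++ x) -> adm u x.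
Proof. by move=> /asboolP[z]; rewrite ok_cat => /andP[h _]; apply/asboolP; exists z. Qed.

Lemma leq_cnt u u' n : (forall w, size w = n -> adm u w -> adm u' w) ->
  (cnt u n <= cnt u' n)%N.
Proof.
move=> uu; rewrite /cnt big_seq [leqRHS]big_seq; apply: leq_sum => w.
rewrite mem_words => /andP[/eqP sw _].
by case: (boolP (adm u w)) => // /(uu _ sw) ->.
Qed.

Lemma cnt_mono u u' n : (forall j, u j <= u' j) -> (cnt u n <= cnt u' n)%N.
Proof.
move=> uu; apply: leq_cnt => w _ /asboolP[z h].
by apply/asboolP; exists z; exact: ok_mono h.
Qed.

Lemma cnt_submul u i j : (cnt u (i + j) <= cnt u i * cnt u j)%N.
Proof.
rewrite /cnt sum_words_cat big_distrl; apply: leq_sum => w _ /=.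
rewrite big_distrr; apply: leq_sum => x _ /=.
by case: (boolP (adm u (w ++ x))) => // h; rewrite (adm_catl h) (adm_catr h).
Qed.

Lemma cnt_full n : cnt (fun=> 1) n = (m.+1 ^ n)%N.
Proof.
rewrite /cnt (eq_bigr (fun=> 1%N)) => [|w _].
  by rewrite sum1_size size_words size_enum_ord.
have [_ _ _ _ a0] := slope_alpha.
suff -> : adm (fun=> 1) w by [].
by apply/asboolP; exists 0; apply: ok_full; rewrite normr0 ltW.
Qed.

(** An interval whose ends move outwards at Lipschitz speed when u is raised. The interval of a word
    that is not admissible is empty, and so stays empty for small raises. *)
Definition moving_itv (P : (nat -> R) -> R -> bool) :=
  exists (lo hi : (nat -> R) -> R) (K : R),
  [/\ 0 <= K, (forall u z, P u z = (lo u <= z <= hi u)) &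
      forall u u' d, 0 <= d -> (forall j, u' j <= u j + d) ->
        lo u - K * d <= lo u' /\ hi u' <= hi u + K * d].

Lemma moving_itvI P Q : moving_itv P -> moving_itv Q ->
  moving_itv (fun u z => P u z && Q u z).
Proof.
move=> [l1 [h1 [K1 [K10 E1 H1]]]] [l2 [h2 [K2 [K20 E2 H2]]]].
exists (fun u => Num.max (l1 u) (l2 u)), (fun u => Num.min (h1 u) (h2 u)), (K1 + K2).
split => [|u z|u u' d d0 uu]; first exact: addr_ge0.
  by rewrite E1 E2 ge_max le_min andbACA.
have [a1 b1] := H1 u u' d d0 uu; have [a2 b2] := H2 u u' d d0 uu.
have k1 := mulr_ge0 K10 d0; have k2 := mulr_ge0 K20 d0.
rewrite mulrDl; split.
  rewrite lerBlDr ge_max -!lerBlDr !le_max.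
  by apply/andP; split; apply/orP; [left|right]; lra.
rewrite -lerBlDr le_min !lerBlDr !ge_min.
by apply/andP; split; apply/orP; [left|right]; lra.
Qed.

Lemma moving_itv_affine j k (d e : R) : d != 0 ->
  moving_itv (fun u z => - u j * a <= e + d * z <= u k * a).
Proof.
have [_ _ _ _ a0] := slope_alpha.
wlog d0 : j k d e / 0 < d => [wl d0|_].
  have [dn|dp|d00] := ltgtP d 0; last by rewrite d00 eqxx in d0.
    have := wl k j (- d) (- e); rewrite oppr_gt0 oppr_eq0 => /(_ dn d0).
    move=> [l [h [K [K0 E H]]]]; exists l, h, K; split => // u z.
    by rewrite -E; apply/idP/idP => /andP[? ?]; apply/andP; split; lra.
  exact: wl.
exists (fun u => (- u j * a - e) / d), (fun u => (u k * a - e) / d), (a / d).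
split => [|u z|u u' t t0 uu]; first by rewrite divr_ge0// ltW.
  by rewrite ler_pdivrMr// ler_pdivlMr// (mulrC z) lerBlDl lerBrDl.
have hj : u' j * a <= (u j + t) * a by rewrite ler_pM2r.
have hk : u' k * a <= (u k + t) * a by rewrite ler_pM2r.
rewrite mulrAC -mulrBl -mulrDl !ler_pM2r ?invr_gt0//.
by split; lra.
Qed.

Lemma ok_moving_itv w : moving_itv (fun u z => ok u w z).
Proof.
elim: w => [|j w IH] /=.
  exists (fun=> - a), (fun=> a), 0; split => // [u z|u u' d _ _] /=.
    by rewrite ler_norml.
  by rewrite mul0r subr0 addr0.
apply: moving_itvI => //; have [c nc cE] := pre_affine w.
have d0 : sigma j * c != 0.
  have [s1 _ _ _ _] := slope_alpha.
  rewrite -normr_gt0 normrM (sigma_norm sigma_alt) mul1r nc invr_gt0.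
  by rewrite exprn_gt0// (lt_trans _ s1).
have [l [h [K [K0 E H]]]] := moving_itv_affine j j.+1 (sigma j * pre w 0) d0.
exists l, h, K; split => // u z; rewrite -E.
suff -> : sigma j * pre w z = sigma j * pre w 0 + sigma j * c * z by [].
by rewrite -mulrA -[in c * z](subr0 z) -cE; ring.
Qed.

Lemma cnt_usc u n :
  exists2 d, 0 < d & forall u', (forall j, u' j <= u j + d) -> (cnt u' n <= cnt u n)%N.
Proof.
have [d d0 hd] : exists2 d, 0 < d & forall w, w \in words letters n ->
    forall u', (forall j, u' j <= u j + d) -> adm u' w -> adm u w.
  apply: common_delta => [w d d' hd d'0 dd u' hu|w _].
    by apply: hd => j; apply: le_trans (hu j) _; rewrite lerD2l.
  have [l [h [K [K0 E H]]]] := ok_moving_itv w.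
  have [aw|naw] := boolP (adm u w); first by exists 1.
  have lh : h u < l u.
    rewrite ltNge; apply: contra naw => lh; apply/asboolP; exists (l u).
    by rewrite E lexx.
  (* Both ends together move by at most 2 K times the raise, which is less than the distance l u - h
     u by which the interval fails to exist. *)
  have dp : 0 < (l u - h u) / (2 * K + 1).
    by rewrite divr_gt0 ?subr_gt0// ltr_wpDl// mulr_ge0.
  exists ((l u - h u) / (2 * K + 1)) => // u' hu /asboolP[z].
  rewrite E => /andP[lz zh]; have [] := H u u' _ (ltW dp) hu.
  set t := _ / _ => lt ht; exfalso.
  have : l u - h u = t * (2 * K + 1) by rewrite divfK// gt_eqF// ltr_wpDl// mulr_ge0.
  by move: dp; rewrite -/t; lra.
exists d => // u' hu; apply: leq_cnt => w sw; apply: hd => //.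
by rewrite mem_words sw eqxx; apply/allP => j _; rewrite /= mem_enum.
Qed.

(* The margin gap / s^N lets [ok u w] survive a small decrease of u on the
   whole cylinder of b. *)
Definition cov N u w b := `[< exists z1 z2, [/\ ok u w z1, ok u w z2 &
  forall x, `|x| <= a -> z1 + gap / s ^+ N <= pre b x <= z2 - gap / s ^+ N] >].

(** A point starting with b lies between the two witnesses for w, so by convexity the conditions
    along w hold for free; the witnesses for c are kept. *)
Lemma cov_trans N u w b x c : (forall j, u j <= 1) ->
  cov N u w b -> cov N u (b ++ x) c -> cov N u (w ++ b ++ x) c.
Proof.
have [s1 _ _ _ _] := slope_alpha; have s0 : 0 < s by apply: lt_trans s1.
move=> u1 /asboolP[z1 [z2 [ok1 ok2 H]]] /asboolP[y1 [y2 [oy1 oy2 H']]].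
have e0 : 0 < gap / s ^+ N by rewrite divr_gt0 ?gap_gt0 ?exprn_gt0.
have ext y : ok u (b ++ x) y -> ok u (w ++ b ++ x) y.
  rewrite [in X in _ -> X]ok_cat => oy; rewrite oy /= pre_cat.
  have /H hb : `|pre x y| <= a by apply: pre_le; exact: ok_le oy.
  by apply: (ok_convex (z1 := z1) (z2 := z2)) => //; apply/andP; split; lra.
by apply/asboolP; exists y1, y2; split => //; exact: ext.
Qed.

Lemma pre_itv w x y z : `|x| <= a -> `|z| <= a -> pre w x <= y <= pre w z ->
  exists2 t, `|t| <= a & pre w t = y.
Proof.
have [s1 _ _ _ _] := slope_alpha.
have [c nc cE] := pre_affine w.
have c0 : c != 0.
  by rewrite -normr_gt0 nc invr_gt0 exprn_gt0// (lt_trans _ s1).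
rewrite !ler_norml => hx hz hy; set t := z + (y - pre w z) / c.
have tE : pre w t = y.
  have : pre w t - pre w z = y - pre w z by rewrite cE /t addrAC subrr add0r mulrC divfK.
  lra.
exists t => //; have h1 := cE t x; have h2 := cE z t; rewrite tE in h1 h2.
have h1' : 0 <= c * (t - x) by rewrite -h1; lra.
have h2' : 0 <= c * (z - t) by rewrite -h2; lra.
rewrite ler_norml; have [cn|cp|c00] := ltgtP c 0; last by rewrite c00 eqxx in c0.
  by move: h1' h2'; rewrite !nmulr_rge0//; lra.
by move: h1' h2'; rewrite !pmulr_rge0//; lra.
Qed.

(** The images of J under [pre w] and [pre w'] are disjoint intervals, so comparing one pair of
    points orders all pairs, and [pre_gap] bounds their distance. *)
Lemma pre_separated w w' x x' z z' : size w = size w' -> w != w' ->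
  `|x| <= a -> `|x'| <= a -> `|z| <= a -> `|z'| <= a ->
  pre w x < pre w' x' -> pre w z + gap / s ^+ size w <= pre w' z'.
Proof.
have [s1 _ _ _ _] := slope_alpha; have s0 : 0 < s by apply: lt_trans s1.
move=> sw ww hx hx' hz hz' lt.
have e0 : 0 < gap / s ^+ size w by rewrite divr_gt0 ?gap_gt0 ?exprn_gt0.
have far t t' : `|t| <= a -> `|t'| <= a -> pre w t <> pre w' t'.
  by move=> ht ht' e; move/eqP: ww; apply; apply: pre_inj e.
have step y : `|y| <= a -> pre w y < pre w' x'.
  move=> hy; rewrite ltNge; apply/negP => le.
  have [|t ht] := @pre_itv w x (pre w' x') y hx hy; last exact: far.
  by rewrite le ltW.
have {}step : pre w z < pre w' z'.
  rewrite ltNge; apply/negP => le.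
  have [|t ht] := @pre_itv w' z' (pre w z) x' hz' hx'; last first.
    by move=> /esym; exact: far.
  by rewrite le ltW ?step.
have [+ _] := pre_gap sw ww hz hz'.
by rewrite distrC gtr0_norm ?subr_gt0//; lra.
Qed.

(** The end points allowed by w form an interval; a cylinder lying between two cylinders that this
    interval meets is covered. Only the two outermost can fail. *)
Lemma few_uncovered N u w :
  (\sum_(b <- words letters N) (adm u (w ++ b) && ~~ cov N u w b) <= 2)%N.
Proof.
rewrite big_seq (eq_bigr (fun b => nat_of_bool ((size b == N) &&
  (adm u (w ++ b) && ~~ cov N u w b)))); last first.
  by move=> b; rewrite mem_words => /andP[-> _].
rewrite -big_seq; apply: sum_bool_le2; first by rewrite words_uniq// enum_uniq.
have point b : (size b == N) && (adm u (w ++ b) && ~~ cov N u w b) ->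
   [/\ size b = N, ~ cov N u w b & exists z, `|z| <= a /\ ok u w (pre b z)].
  move=> /and3P[/eqP sb /asboolP[z] + /negP]; rewrite ok_cat => /andP[oz ow].
  by split => //; exists z; split => //; exact: ok_le oz.
have mid b1 b2 b3 z1 z2 z3 : size b1 = N -> size b2 = N -> size b3 = N ->
    b1 != b2 -> b2 != b3 -> `|z1| <= a -> `|z2| <= a -> `|z3| <= a ->
    ok u w (pre b1 z1) -> ok u w (pre b3 z3) ->
    pre b1 z1 < pre b2 z2 -> pre b2 z2 < pre b3 z3 -> cov N u w b2.
  move=> sb1 sb2 sb3 n12 n23 h1 h2 h3 o1 o3 l12 l23; apply/asboolP.
  exists (pre b1 z1), (pre b3 z3); split => // x hx; apply/andP; split.
    by rewrite -sb1; apply: (pre_separated _ n12 h1 h2); rewrite ?sb1.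
  by rewrite lerBrDr -sb2; apply: (pre_separated _ n23 h2 h3); rewrite ?sb2.
move=> b1 b2 b3 /point[s1 c1 [z1 [h1 o1]]] /point[s2 c2 [z2 [h2 o2]]]
  /point[s3 c3 [z3 [h3 o3]]] n12 n13 n23.
have n21 : b2 != b1 by rewrite eq_sym.
have n31 : b3 != b1 by rewrite eq_sym.
have n32 : b3 != b2 by rewrite eq_sym.
have ne b b' z z' : size b = N -> size b' = N -> b != b' -> `|z| <= a -> `|z'| <= a ->
    pre b z < pre b' z' \/ pre b' z' < pre b z.
  move=> sb sb' bb hz hz'; have [|l|e] := ltgtP (pre b z) (pre b' z'); [by left|by right|].
  by case/eqP: bb; apply: pre_inj e => //; rewrite sb.
(* Six of the eight patterns order the three cylinders, and the middle one is covered; the other two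
   are cyclic. *)
case: (ne _ _ _ _ s1 s2 n12 h1 h2) => l12; case: (ne _ _ _ _ s1 s3 n13 h1 h3) => l13;
  case: (ne _ _ _ _ s2 s3 n23 h2 h3) => l23.
- by apply: c2; apply: (mid b1 b2 b3 z1 z2 z3).
- by apply: c3; apply: (mid b1 b3 b2 z1 z3 z2).
- by have := lt_trans (lt_trans l12 l23) l13; rewrite ltxx.
- by apply: c1; apply: (mid b3 b1 b2 z3 z1 z2).
- by apply: c1; apply: (mid b2 b1 b3 z2 z1 z3).
- by have := lt_trans (lt_trans l13 l23) l12; rewrite ltxx.
- by apply: c3; apply: (mid b2 b3 b1 z2 z3 z1).
- by apply: c2; apply: (mid b3 b2 b1 z3 z2 z1).
Qed.

Lemma cnt_block u N k :
  (\sum_(W <- words (words letters N) k) adm u (flatten W) = cnt u (k * N))%N.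
Proof. exact: (sum_words_flatten letters N k (fun w => nat_of_bool (adm u w))). Qed.

Lemma grow_block u N (y : R) : (0 < N)%N -> 1 <= y ->
  grow (fun k => cnt u (k * N)) (y ^+ N) -> grow (cnt u) y.
Proof.
move=> N0 y1; have y0 : 0 < y by apply: lt_le_trans y1.
move=> /(growW (exprn_gt0 N y0))[C C0 HC].
exists (C * \sum_(r < N) (cnt u r)%:R) => n.
rewrite {1}(divn_eq n N); set q := (n %/ N)%N; set r := (n %% N)%N.
have rN : (r < N)%N by rewrite ltn_mod.
have h : (cnt u (q * N + r))%:R <= (cnt u (q * N) * cnt u r)%:R :> R.
  by rewrite ler_nat cnt_submul.
apply: (le_trans h); rewrite natrM [leRHS]mulrAC; apply: ler_pM => //.
  apply: le_trans (HC q) _; rewrite -exprM ler_pM2l// ler_weXn2l//.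
  by rewrite mulnC leq_divM.
by rewrite (bigD1 (Ordinal rN))//= lerDl sumr_ge0.
Qed.

(** All words counted by [G] start with b and may be followed by any point of the cylinder of b, so
    they concatenate freely. *)
Lemma cnt_concat u' (G : pred (seq 'I_m.+1)) (b : seq 'I_m.+1) L k :
  (forall V, size V = L -> G V ->
     exists x, V = b ++ x /\ forall y, `|y| <= a -> ok u' V (pre b y)) ->
  ((\sum_(V <- words letters L) G V) ^ k <= cnt u' (k * L))%N.
Proof.
have [_ _ _ _ a0] := slope_alpha.
move=> HG; rewrite -cnt_block.
set Gs := [seq V <- words letters L | G V].
have -> : (\sum_(V <- words letters L) G V = size Gs)%N.
  by rewrite -big_mkcond sum1_count size_filter.
apply: leq_trans (sum_words_filter G (words letters L) k
   (fun W => nat_of_bool (adm u' (flatten W)))).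
rewrite -/Gs -size_words -sum1_size big_seq [leqRHS]big_seq.
apply: leq_sum => W; rewrite mem_words => /andP[_ aW].
(* Words are prepended one at a time, and the invariant is that the starting point stays in the
   cylinder of b. *)
suff [z [zb zo]] : exists z, (exists2 y, `|y| <= a & pre (flatten W) z = pre b y) /\
    ok u' (flatten W) z.
  by rewrite (_ : adm u' _)//; apply/asboolP; exists z.
elim: W aW => [_|V W IH /= /andP[VG /IH[z [[y hy zy] zo]]]] /=.
  exists (pre b 0); split; first by exists 0 => //; rewrite normr0 ltW.
  by apply: pre_le; rewrite normr0 ltW.
move: VG; rewrite mem_filter mem_words => /and3P[gV /eqP sV _].
have [x [Vx oV]] := HG V sV gV.
exists z; rewrite pre_cat ok_cat zo zy oV//; split => //.
by exists (pre x (pre b y)); [do 2 apply: pre_le|rewrite Vx pre_cat].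
Qed.

Lemma cnt_lsc u (x y : R) : (forall j, u j <= 1) -> 1 <= x -> x < y ->
  ~ grow (cnt u) y ->
  exists2 d, 0 < d & forall u', (forall j, u j - d <= u' j) -> ~ grow (cnt u') x.
Proof.
have [s1 _ _ _ a0] := slope_alpha; have s0 : 0 < s by apply: lt_trans s1.
move=> u1 x1 xy ng; set t := (x + y) / 2.
have x0 : 0 < x by apply: lt_le_trans x1.
have xt : x < t by rewrite /t; lra.
have ty : t < y by rewrite /t; lra.
have t1 : 1 < t by apply: le_lt_trans xt.
have t0 : 0 < t by apply: lt_trans t1.
have y0 : 0 < y by apply: lt_trans ty.
(* Blocks of N letters turn the rate t > 1 into t^N > 2, as [horseshoe] requires. *)
have [N N0 tN] : exists2 N, (0 < N)%N & 2 < t ^+ N.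
  have [D D0 HD] := linear_le_exp ltr01 t1.
  have /archi_boundP : 0 <= 2 * D by rewrite mulr_ge0 ?ltW//.
  move: (Num.bound _) => N hN; exists N.+1 => //.
  rewrite -(ltr_pM2r D0) [ltRHS]mulrC; apply: lt_le_trans (HD N.+1).
  by rewrite expr1n mulr1; apply: lt_le_trans hN _; rewrite ler_nat -addn2 leq_addr.
have tyN : t ^+ N < y ^+ N by rewrite ltrXn2r ?nnegrE ?ltW// -lt0n.
have [|||||b bN [n hn]] := @horseshoe R _ (words letters N)
  (fun W => adm u (flatten W)) (fun W b => cov N u (flatten W) b) _ _ _ _ _ _ tN tyN.
- by move=> W X; rewrite flatten_cat; exact: adm_catl.
- by move=> W X; rewrite flatten_cat; exact: adm_catr.
- move=> W _; apply: leq_trans (few_uncovered N u (flatten W)).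
  by apply: leq_sum => c _; rewrite flatten_rcons.
- by move=> W c X e /=; rewrite flatten_cat /=; exact: cov_trans.
- apply: contra_not ng => g; apply: (grow_block N0 (ltW (le_lt_trans x1 xy))).
  by apply: grow_le g => k; rewrite cnt_block.
have sb : size b = N by move: bN; rewrite mem_words => /andP[/eqP].
set L := (N + n * N)%N.
(* Words of length L that begin with b and cover b: the block b followed by the n blocks given by
   [horseshoe]. *)
pose G V := (take N V == b) && cov N u V b.
have {}hn : t ^+ L <= (\sum_(V <- words letters L) G V)%:R.
  rewrite {1}/L -mulSn mulnC exprM; apply: le_trans hn _; rewrite ler_nat.
  rewrite (sum_words_flatten letters N n (fun w => nat_of_bool (cov N u (b ++ w) b))).
  rewrite /L sum_words_cat.
  apply: leq_trans (leq_sum_mem (fun c => \sum_(V <- words letters (n * N)) G (c ++ V))%N bN).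
  by apply: leq_sum => V _; rewrite /G take_size_cat// eqxx.
have e0 : 0 < gap / s ^+ N by rewrite divr_gt0 ?gap_gt0 ?exprn_gt0.
(* The margin of [cov], contracted along a word of length L and measured in units of [a]: the
   largest decrease that [ok_inside] allows. *)
exists (gap / s ^+ N / s ^+ L / a) => [|u' hu [C HC]].
  by rewrite divr_gt0// divr_gt0// exprn_gt0.
have big k : t ^+ (k * L) <= (cnt u' (k * L))%:R.
  apply: (@le_trans _ _ ((\sum_(V <- words letters L) G V) ^ k)%:R).
    rewrite natrX mulnC exprM; apply: lerXn2r => //.
      by rewrite nnegrE exprn_ge0// ltW.
    by rewrite nnegrE.
  rewrite ler_nat (@cnt_concat u' G b)// => V sV /andP[/eqP tV].
  move=> /asboolP[z1 [z2 [okz1 okz2 H]]]; exists (drop N V); split.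
    by rewrite -{1}tV cat_take_drop.
  move=> v hv; apply: (ok_inside _ (H v hv) hu _ okz1 okz2); first exact: ltW.
  by rewrite sV divfK// gt_eqF.
have [D D0 HD] := linear_le_exp x0 xt.
(* Growth of rate x would give t^(kL) <= C x^(kL), whereas (kL + 1) x^(kL) <= D t^(kL); so kL + 1
   would be bounded. *)
have DC k : (k * L).+1%:R <= D * C.
  rewrite -(ler_pM2r (exprn_gt0 (k * L) x0)); apply: le_trans (HD _) _.
  by rewrite -mulrA ler_pM2l// (le_trans (big k)).
have DC0 : 0 <= D * C by apply: le_trans (DC 0%N).
have := archi_boundP DC0; set k := Num.bound _; apply/negP; rewrite -leNgt.
apply: le_trans (DC k); rewrite ler_nat leqW// leq_pmulr// /L.
by rewrite addn_gt0 N0.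
Qed.

Definition lap (y : R) : 'I_m.+1 := odflt ord0 [pick j | `|y - Ihat j| <= a / s].

(** Reads a word off its starting point, so that orbit pieces shadowing one of finitely many points
    cost only a bounded number of choices per length. *)
Fixpoint itin n y : seq 'I_m.+1 :=
  if n is n'.+1 then lap y :: itin n' (sigma (lap y) * s * (y - Ihat (lap y))) else [::].

Lemma take_itin k n y : (k <= n)%N -> take k (itin n y) = itin k y.
Proof.
elim: n k y => [|n IH] [|k] y //=; rewrite ltnS => kn; by rewrite IH.
Qed.

Lemma lap_branch j y : `|y| <= a -> lap (branch j y) = j.
Proof.
move=> ya; rewrite /lap; case: pickP => [k /=|/(_ j)]; last by rewrite branch_J.
have [s1 r0 r1 aE a0] := slope_alpha.
apply: contraTeq => kj; rewrite -ltNge.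
have := @branch_gap j k y (sigma k * s * 0) _ ya; rewrite mulr0 normr0 ltW// eq_sym.
move=> /(_ kj isT); rewrite {2}/branch mulr0 mul0r addr0 /gap.
have h (i i' : 'I_m.+1) : (i < i')%N -> (Ihat i : R) + 2 <= Ihat i'.
  by rewrite -(@ler_nat R) -natr1 /Ihat; lra.
have := branch_J j ya; set b := branch j y => bj _.
move: kj; rewrite -val_eqE neq_ltn => /orP[] /h hh; move: bj; rewrite ler_norml => bj.
  by apply: lt_le_trans (ler_norm _); lra.
by rewrite distrC; apply: lt_le_trans (ler_norm _); lra.
Qed.

Lemma itin_branch n j y : `|y| <= a -> itin n.+1 (branch j y) = j :: itin n y.
Proof.
have [s1 _ _ _ _] := slope_alpha; have s0 : s != 0 by rewrite gt_eqF// (lt_trans _ s1).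
move=> ya; rewrite /= lap_branch//; congr (_ :: itin n _).
have -> : sigma j * s * (branch j y - Ihat j) = sigma j * sigma j * y * (s / s).
  by rewrite /branch; ring.
by rewrite (sigma_sqr sigma_alt) divff// mul1r mulr1.
Qed.

Lemma itin_pre w z : `|z| <= a -> itin (size w) (pre w z) = w.
Proof. by move=> za; elim: w => // j w IH; rewrite itin_branch ?IH ?pre_le. Qed.

(** * Words of a clamped parameter, with lam = 1 - t *)

Section Clamping.
Variables (q : nat -> R) (lam : R).
Hypothesis lam01 : 0 <= lam <= 1.
Hypothesis q0 : q 0%N = 1.
Hypothesis qm : q m.+1 = 1.
Hypothesis q_le : forall j, (0 < j <= m)%N -> q j <= lam.

(** Values beyond lam a occur only on the sides of laps 0 and m that end at an end point of J; the
    other sides end at clamped turning points. *)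
Lemma clamped_letter (j : 'I_m.+1) y :
  - q j * a <= sigma j * y <= q j.+1 * a ->
  ((0 < j)%N -> - (lam * a) <= sigma j * y) /\ ((j < m)%N -> sigma j * y <= lam * a).
Proof.
have [_ _ _ _ a0] := slope_alpha.
move=> /andP[l h]; split => hj.
  apply: le_trans l; rewrite mulNr lerN2 ler_pM2r// q_le// hj -ltnS ltn_ord//.
by apply: le_trans h _; rewrite ler_pM2r// q_le.
Qed.

Lemma sigma_norm_le j y x : (`|y| <= x) = (- x <= sigma j * y <= x).
Proof. by rewrite -ler_norml normrM (sigma_norm sigma_alt) mul1r. Qed.

(** Since [Ihat] of the last lap is m, this says s (a - m) = a: end points of J are mapped to end
    points of J. *)
Lemma alpha_mul : a * s = m%:R * s + a.
Proof.
have [s1 _ _ aE _] := slope_alpha; have s0 : s != 0 by rewrite gt_eqF// (lt_trans _ s1).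
have -> : a * s = (m%:R + a / s) * s by rewrite -aE.
by rewrite mulrDl divfK.
Qed.

(** Only the outer sides of laps 0 and m need a check. There the end point of J goes to an end point
    and distances from it are multiplied by s, so points within lam a are sent no farther than s
    (lam a - m) <= lam a. *)
Lemma clamped_invariant (j : 'I_m.+1) y : - q j * a <= sigma j * y <= q j.+1 * a ->
  `|branch j y| <= lam * a -> `|y| <= lam * a.
Proof.
have [s1 r0 r1 aE a0] := slope_alpha; have s0 : 0 < s by apply: lt_trans s1.
move=> hq; have [h1 h2] := clamped_letter hq.
rewrite ler_norml (sigma_norm_le j) /branch => /andP[b1 b2].
have := lam01 => /andP[lam0 lam1].
have lm : lam * (a * s - a) <= m%:R * s.
  by rewrite alpha_mul addrK ler_piMl// mulr_ge0// ltW.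
have E : sigma j * y = s * (sigma j * y / s) by rewrite [RHS]mulrC divfK// gt_eqF.
apply/andP; split.
  have [j0|/h1//] := posnP j.
  rewrite E; move: b1; set t := sigma j * y / s; rewrite /Ihat j0 mulr0 sub0r => b1.
  have : s * (m%:R - lam * a) <= s * t by rewrite ler_pM2l//; lra.
  lra.
have [/h2//|] := ltnP j m => mj.
have jm : nat_of_ord j = m by apply/eqP; rewrite eqn_leq mj -ltnS ltn_ord.
rewrite E; move: b2; set t := sigma j * y / s; rewrite /Ihat jm => b2.
have : s * t <= s * (lam * a - m%:R) by rewrite ler_pM2l//; lra.
lra.
Qed.

(* Outside [-lam a, lam a] the orbit follows the itinerary of an end point of J. *)
Lemma clamped_prefix w z : ok q w z ->
  exists w1 t, [/\ w = w1 ++ t,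
    w1 = itin (size w1) (if 0 <= pre w z then a else - a) &
    t = [::] \/ exists j x, t = j :: x /\ `|pre x z| <= lam * a].
Proof.
have [s1 r0 r1 aE a0] := slope_alpha; have s0 : 0 < s by apply: lt_trans s1.
have /andP[lam0 lam1] := lam01; have la0 : 0 <= lam * a by rewrite mulr_ge0// ltW.
have naN : `|- a| <= a by rewrite normrN gtr0_norm.
have na : `|a| <= a by rewrite gtr0_norm.
have mR : 1 <= (m%:R : R) by rewrite ler1n.
elim: w => [_|j w IH /= /andP[/IH[w1 [t [wE w1E tE]]] hq]].
  by exists [::], [::]; split => //; left.
have [yl|yl] := lerP `|pre w z| (lam * a).
  by exists [::], (j :: w); split => //; right; exists j, w.
(* As [pre w z] lies beyond lam a, [j] is an outer lap, and the new point follows the end point of J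
   on its own side. *)
have [h1 h2] := clamped_letter hq.
have y0 : pre w z != 0 by rewrite -normr_gt0 (le_lt_trans la0).
have yl' : ~~ (- (lam * a) <= sigma j * pre w z <= lam * a).
  by rewrite -sigma_norm_le -ltNge.
exists (j :: w1), t; split => //; first by rewrite wE.
rewrite [in RHS]/size -/(size w1).
have [j0|jp] := posnP j.
  have neg : sigma j * pre w z < - (lam * a).
    rewrite ltNge; apply: contra yl' => hh; rewrite hh h2// j0//.
  have -> : (0 <= branch j (pre w z)) = false.
    apply/negbTE; rewrite -ltNge /branch /Ihat j0 mulr0 sub0r.
    have : sigma j * pre w z / s < 0 by rewrite pmulr_llt0 ?invr_gt0//; lra.
    by lra.
  have sE : sigma j * (if 0 <= pre w z then a else - a) = - a.
    case: (sigma_pm1 j) => sj; move: neg; rewrite sj ?mul1r ?mulN1r.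
      by case: (lerP 0 (pre w z)) => //; lra.
    by case: (lerP 0 (pre w z)) => //; lra.
  have -> : - a = branch j (if 0 <= pre w z then a else - a).
    by rewrite /branch sE /Ihat j0 mulr0 sub0r mulNr -opprD -aE.
  by rewrite itin_branch -?w1E//; case: ifP.
have jm : nat_of_ord j = m.
  apply/eqP; rewrite eqn_leq -ltnS ltn_ord /= leqNgt; apply/negP => jm.
  by move: yl'; rewrite h1// h2.
have pos : lam * a < sigma j * pre w z.
  rewrite ltNge; apply: contra yl' => hh; rewrite hh h1//.
have -> : (0 <= branch j (pre w z)) = true.
  rewrite /branch /Ihat jm.
  have : 0 < sigma j * pre w z / s by rewrite divr_gt0//; lra.
  by lra.
have sE : sigma j * (if 0 <= pre w z then a else - a) = a.
  case: (sigma_pm1 j) => sj; move: pos; rewrite sj ?mul1r ?mulN1r.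
    by case: (lerP 0 (pre w z)) => //; lra.
  by case: (lerP 0 (pre w z)) => //; rewrite ?opprK//; lra.
have aB : a = branch j (if 0 <= pre w z then a else - a).
  by rewrite /branch sE /Ihat jm {1}aE; lra.
have -> : itin (size w1).+1 a = j :: w1; last by [].
by rewrite {1}aB itin_branch -?w1E//; case: ifP.
Qed.

(** A word is cut into a prefix following a or -a, a letter, a word of [P], a letter and a tail
    following lam a or -lam a. The factors count two signs, two letters, the length of the prefix
    and the word; [take n] allows arbitrary padding when pieces are missing. *)
Lemma cnt_clamped (P : pred (seq 'I_m.+1)) n : P [::] ->
  (forall r z, ok q r z -> `|pre r z| <= lam * a -> exists w2 t,
    [/\ r = w2 ++ t, P w2 &
        t = [::] \/ exists j x, t = j :: x /\ `|pre x z| = lam * a]) ->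
  (cnt q n <= 4 * m.+1 ^ 2 * (n.+1 * \sum_(k < n.+1) \sum_(w <- words letters k) P w))%N.
Proof.
have [s1 r0 r1 aE a0] := slope_alpha.
move=> P0 HP.
pose prodl (X Y : Type) (p : seq X) (r : seq Y) := [seq (x, y) | x <- p, y <- r].
pose Pw := flatten [seq [seq w <- words letters k | P w] | k <- index_iota 0 n.+1].
pose data := prodl _ _ [:: a; - a] (prodl _ _ (iota 0 n.+1) (prodl _ _ letters
  (prodl _ _ Pw (prodl _ _ letters [:: lam * a; - (lam * a)])))).
pose f (d : R * (nat * ('I_m.+1 * (seq 'I_m.+1 * ('I_m.+1 * R))))) :=
  let: (e1, (k, (j, (w, (j', e2))))) := d in
  take n (take k (itin n e1) ++ j :: w ++ j' :: itin n e2).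
have -> : cnt q n = size [seq w <- words letters n | adm q w].
  by rewrite /cnt -big_mkcond sum1_count size_filter.
have sd : (size [seq f d | d <- data] =
  4 * m.+1 ^ 2 * (n.+1 * \sum_(k < n.+1) \sum_(w <- words letters k) P w))%N.
  rewrite size_map /data /prodl !size_allpairs size_iota size_enum_ord /=.
  have -> : size Pw = (\sum_(k < n.+1) \sum_(w <- words letters k) P w)%N.
    rewrite /Pw size_flatten /shape -map_comp sumnE big_map.
    rewrite big_mkord.
    by apply: eq_bigr => k _ /=; rewrite size_filter -sum1_count big_mkcond.
  by move: (\sum_(k < n.+1) _)%N => S; rewrite expnS expn1; ring.
rewrite -sd; apply: uniq_leq_size; first by rewrite filter_uniq// words_uniq// enum_uniq.
move=> w; rewrite mem_filter mem_words => /and3P[/asboolP[z oz] /eqP sw _].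
have lmem (j : 'I_m.+1) : j \in letters by rewrite mem_enum.
have inPw x : (size x <= n)%N -> P x -> x \in Pw.
  move=> sx Px; apply/flattenP; exists [seq w <- words letters (size x) | P w].
    by apply/mapP; exists (size x) => //; rewrite mem_index_iota.
  by rewrite mem_filter Px mem_words eqxx; apply/allP => ? _; exact: lmem.
have mk e1 k j x j' e2 : (e1 == a) || (e1 == - a) -> (k <= n)%N -> (size x <= n)%N -> P x ->
    (e2 == lam * a) || (e2 == - (lam * a)) ->
    w = f (e1, (k, (j, (x, (j', e2))))) -> w \in [seq f d | d <- data].
  move=> he1 hk hx Px he2 ->; apply: map_f.
  apply: allpairs_f; first by rewrite !inE.
  apply: allpairs_f; first by rewrite mem_iota.
  apply: allpairs_f => //; apply: allpairs_f; first exact: inPw.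
  by apply: allpairs_f => //; rewrite !inE.
have [w1 [t [wE w1E tE]]] := clamped_prefix oz.
set e1 := (if _ then a else - a) in w1E.
have he1 : (e1 == a) || (e1 == - a) by rewrite /e1; case: ifP; rewrite eqxx ?orbT.
have sw1 : (size w1 <= n)%N by rewrite -sw wE size_cat leq_addr.
have w1T : take (size w1) (itin n e1) = w1 by rewrite take_itin.
case: tE => [t0|[j [r [tjr hr]]]].
  apply: (mk e1 (size w1) ord0 [::] ord0 (lam * a)); rewrite ?eqxx//.
  rewrite /f w1T take_size_cat; first by rewrite wE t0 cats0.
  by rewrite -sw wE t0 cats0.
have : ok q (rcons w1 j ++ r) z by rewrite cat_rcons -tjr -wE.
rewrite ok_cat => /andP[or _].
have [w2 [t2 [rE Pw2 t2E]]] := HP r z or hr.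
have sw2 : (size w2 <= n)%N.
  rewrite -sw wE tjr rE !size_cat /= size_cat.
  by apply: leq_trans (leq_addl _ _); rewrite leqW ?leq_addr.
case: t2E => [t20|[j' [x [t2x hx]]]].
  apply: (mk e1 (size w1) j w2 ord0 (lam * a)); rewrite ?eqxx//.
  rewrite /f w1T -cat_cons catA take_size_cat.
    by rewrite wE tjr rE t20 cats0.
  by rewrite -sw wE tjr rE t20 cats0.
apply: (mk e1 (size w1) j w2 j' (pre x z)) => //.
  have : `|pre x z| == lam * a by rewrite hx.
  by rewrite eqr_norml => /andP[].
have sx : (size x <= n)%N.
  rewrite -sw wE tjr rE t2x !size_cat /= size_cat /=.
  by apply: leq_trans (leq_addl _ _); rewrite leqW// (leq_trans _ (leq_addl _ _)).
rewrite /f w1T.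
have -> : itin n (pre x z) = x ++ drop (size x) (itin n (pre x z)).
  by rewrite -{1}(cat_take_drop (size x) (itin n _)) take_itin// itin_pre// (ok_le or).
have -> : w1 ++ j :: w2 ++ j' :: x ++ drop (size x) (itin n (pre x z)) =
          w ++ drop (size x) (itin n (pre x z)).
  by rewrite wE tjr rE t2x -!catA /= -!catA.
by rewrite take_size_cat.
Qed.

(** Cut at the first transition allowed by q but not by u. It occurs at a turning point raised to
    -lam, which forces the next point y to satisfy |y| >= lam a, while invariance gives |y| <= lam
    a. *)
Lemma grow_clamped u (x y : R) : u 0%N = 1 -> u m.+1 = 1 ->
  (forall j, (0 < j <= m)%N -> q j <= u j \/ (q j = - lam /\ u j <= - lam)) ->
  1 <= x -> x < y -> grow (cnt u) x -> grow (cnt q) y.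
Proof.
have [s1 r0 r1 aE a0] := slope_alpha.
move=> u0 um qu x1 xy gu; have x0 : 0 < x by apply: lt_le_trans x1.
have xt : x < (x + y) / 2 by lra.
have ty : (x + y) / 2 < y by lra.
apply: (grow_linear (c := (4 * m.+1 ^ 2)%N) (lt_trans x0 xt) ty _ (grow_sum x1 xt gu)) => n.
apply: cnt_clamped.
  by apply/asboolP; exists 0; rewrite /= normr0 ltW.
move=> r z or hy.
suff [w2 [t [rE ow tE]]] : exists w2 t, [/\ r = w2 ++ t, ok u w2 (pre t z) &
    t = [::] \/ exists j x, t = j :: x /\ `|pre x z| = lam * a].
  by exists w2, t; split => //; apply/asboolP; exists (pre t z).
elim: r or hy => [|j r IH] /=.
  by move=> za _; exists [::], [::]; split => //; left.
move=> /andP[or hq] hy; have hy' := clamped_invariant hq hy.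
have [w2 [t [rE ow tE]]] := IH or hy'.
have [uok|unok] := boolP (- u j * a <= sigma j * pre r z <= u j.+1 * a).
  exists (j :: w2), t; split => //=; first by rewrite rE.
  by rewrite ow /= -pre_cat -rE.
exists [::], (j :: r); split => //=.
  by apply: (@pre_le (j :: r)); exact: ok_le or.
right; exists j, r; split => //; apply/eqP.
move: hy'; rewrite le_eqVlt => /orP[//|]; rewrite ltNge => /negP hn; exfalso.
apply: hn; move/andP: hq => [l h].
move: unok; rewrite negb_and -!ltNge => /orP[lu|hu].
  have [j0|jp] := posnP j; first by move: l lu; rewrite j0 q0 u0; lra.
  have jP : (0 < j <= m)%N by rewrite jp -ltnS ltn_ord.
  have [qu1|[qE _]] := qu j jP.
    by move: qu1; rewrite -(ler_pM2r a0) => ?; lra.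
  move: l; rewrite qE opprK => l.
  apply: le_trans l _; apply: le_trans (ler_norm _) _.
  by rewrite normrM (sigma_norm sigma_alt) mul1r.
have [jm|] := ltnP j m; last first.
  rewrite leq_eqVlt ltnNge -ltnS ltn_ord orbF => /eqP mj.
  by move: h hu; rewrite -mj qm um; lra.
have jP : (0 < j.+1 <= m)%N by rewrite jm.
have [qu1|[qE _]] := qu j.+1 jP.
  by move: qu1; rewrite -(ler_pM2r a0) => ?; lra.
move: h; rewrite qE mulNr => h.
have : lam * a <= - (sigma j * pre r z) by lra.
move=> /le_trans; apply; apply: le_trans (ler_norm _) _.
by rewrite normrN normrM (sigma_norm sigma_alt) mul1r.
Qed.

(** The invariant interval is {0}, so only the empty word is needed in the middle and the count is
    linear in n. *)
Lemma grow_clamped0 (y : R) : lam = 0 -> 1 < y -> grow (cnt q) y.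
Proof.
move=> l0 y1.
have g : grow (fun n => (\sum_(k < n.+1) \sum_(w <- words letters k) nilp w)%N) (1 : R).
  exists 1 => n; rewrite expr1n mulr1 lern1 big_ord_recl big_seq1 big1//= => k _.
  by rewrite sum_wordsS; apply: big1 => j _; apply: big1 => w _.
apply: (grow_linear (c := (4 * m.+1 ^ 2)%N) ltr01 y1 _ g) => n.
apply: cnt_clamped => // -[|j r] z or hy.
  by exists [::], [::]; split => //; left.
exists [::], (j :: r); split => //; right; exists j, r; split => //.
move: or => /= /andP[_ hq]; have := clamped_invariant hq hy.
by rewrite l0 mul0r normr_le0 => /eqP ->; rewrite normr0.
Qed.

End Clamping.

End Itineraries.

(** * Topological entropy and admissible words *)

Section EntropyBounds.
Context {R : realType} {T : pseudoMetricType R}.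
Variables (K : set T) (f : T -> T).

Let rate (e : R) : \bar R :=
  limn_esup (fun n => ((n%:R^-1)%:E * lne (separated_card K f n e))%E).

Lemma separated_card_ge n (e : R) (E : {fset T}) :
  [set` E] `<=` K -> Defs.separated f n e [set` E] ->
  ((#|` E|%fset%:R)%:E <= separated_card K f n e)%E.
Proof. by move=> EK sE; apply: ereal_sup_ubound; exists E. Qed.

Lemma separated_card_ge0 n (e : R) : (0 <= separated_card K f n e)%E.
Proof.
have := @separated_card_ge n e fset0; rewrite cardfs0; apply.
- by move=> x /=; rewrite inE.
- by move=> x y /=; rewrite inE.
Qed.

Lemma separated_card_noninc n (e e' : R) : e <= e' ->
  (separated_card K f n e' <= separated_card K f n e)%E.
Proof.
move=> ee; apply: ereal_sup_le => _ [E [EK sE] <-]; exists E => //; split => //.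
move=> x y Ex Ey xy; have [k kn nb] := sE x y Ex Ey xy; exists k => //.
by apply: contra_not nb; exact: le_ball.
Qed.

Lemma le_limn_esup (u v : nat -> \bar R) : (forall n, (u n <= v n)%E) ->
  (limn_esup u <= limn_esup v)%E.
Proof.
move=> uv; apply: le_ereal_inf_tmp => _ [A AF <-].
apply: ge_ereal_inf; exists (ereal_sup (u @` A)); first by exists A.
apply: ge_ereal_sup => _ [n An <-]; apply: le_ereal_sup_tmp; by exists (v n).
Qed.

(** A larger scale separates fewer points, so the rate is nonincreasing in e and its limit at 0 from
    the right is a supremum. *)
Lemma topological_entropyE :
  topological_entropy K f = ereal_sup (rate @` [set e | 0 < e]).
Proof.
rewrite /topological_entropy; apply: cvg_lim => //.
have := @nonincreasing_at_right_cvge R rate 0 (BInfty R false).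
rewrite set_itvoy; apply => //.
move=> e e' _ _ ee; apply: le_limn_esup => n; apply: lee_wpmul2l.
  by rewrite lee_fin invr_ge0.
by rewrite lee_lne ?separated_card_noninc// in_itv /= leey separated_card_ge0.
Qed.

Let lne_pow (y : R) n : 0 < y -> (0 < n)%N ->
  ((n%:R^-1)%:E * lne (y ^+ n)%:E = (ln y)%:E)%E.
Proof.
move=> y0 n0; rewrite lne_EFin ?exprn_gt0// lnXn// -EFinM.
by rewrite -[ln y *+ n]mulr_natl mulrA mulVf ?mul1r// pnatr_eq0 -lt0n.
Qed.

Lemma topological_entropy_le (y : R) : 0 < y ->
  (forall e, 0 < e -> exists N, forall n, (N <= n)%N ->
     (separated_card K f n e <= (y ^+ n)%:E)%E) ->
  (topological_entropy K f <= (ln y)%:E)%E.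
Proof.
move=> y0 H; rewrite topological_entropyE; apply: ge_ereal_sup => _ [e e0 <-].
have [N HN] := H e e0; apply: ge_ereal_inf.
exists (ereal_sup ((fun n => ((n%:R^-1)%:E * lne (separated_card K f n e))%E) @`
  [set n | (N.+1 <= n)%N])); first by exists [set n | (N.+1 <= n)%N] => //; exists N.+1.
apply: ge_ereal_sup => _ [n /= Nn <-].
rewrite -(@lne_pow y n) ?(leq_ltn_trans _ Nn)//; apply: lee_wpmul2l.
  by rewrite lee_fin invr_ge0.
have yn : (0 <= (y ^+ n)%:E)%E by rewrite lee_fin exprn_ge0// ltW.
by rewrite lee_lne ?HN ?(ltnW Nn)// in_itv /= leey ?separated_card_ge0 ?yn.
Qed.

Lemma topological_entropy_lt (y e : R) : 0 < y -> 0 < e ->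
  (topological_entropy K f < (ln y)%:E)%E ->
  exists N, forall n, (N <= n)%N -> (separated_card K f n e < (y ^+ n)%:E)%E.
Proof.
move=> y0 e0; rewrite topological_entropyE => lt.
have /ereal_inf_lt[_ [A [N _ NA] <-]] : (rate e < (ln y)%:E)%E.
  by apply: le_lt_trans lt; apply: ereal_sup_ubound; exists e.
move=> ltA; exists N.+1 => n Nn; rewrite ltNge; apply/negP => le.
have : ((ln y)%:E <= ereal_sup ((fun n => ((n%:R^-1)%:E * lne (separated_card K f n e))%E) @` A))%E.
  apply: le_ereal_sup_tmp; exists ((n%:R^-1)%:E * lne (separated_card K f n e))%E.
    by exists n => //; apply: NA; exact: ltnW.
  rewrite -(@lne_pow y n) ?(leq_ltn_trans _ Nn)//; apply: lee_wpmul2l.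
    by rewrite lee_fin invr_ge0.
  have yn : (0 <= (y ^+ n)%:E)%E by rewrite lee_fin exprn_ge0// ltW.
  by rewrite lee_lne ?le// in_itv /= leey ?separated_card_ge0 ?yn.
by rewrite leNgt ltA.
Qed.

End EntropyBounds.

Lemma truncn_eq_dist (R : realType) (x y : R) : 0 <= x -> 0 <= y ->
  Num.truncn x = Num.truncn y -> `|x - y| < 1.
Proof.
move=> /truncn_itv/andP[x1 x2] /truncn_itv/andP[y1 y2] e.
move: x1 x2 y1 y2; rewrite e -!natr1 => ? ? ? ?.
by rewrite ltr_norml; apply/andP; split; lra.
Qed.

(** * Separated orbits compared with admissible words *)

Section Bridge.
Context {R : realType} {m : nat}.
Variable sigma : 'I_m.+1 -> R.
Hypothesis m_gt0 : (0 < m)%N.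
Hypothesis sigma_alt : alternating_signs sigma.

Local Notation s := (@slope R m).
Local Notation a := (@alpha R m).
Local Notation letters := (enum 'I_m.+1).

Implicit Types p : 'rV[R]_m.

(* The values of u = 2p - 1 at the turning points 1, ..., m, completed by the
   value 1 (a full branch) at the two end points of J. *)
Definition upar (p : 'rV[R]_m) (k : nat) : R :=
  if k is k'.+1 then
    if insub k' is Some i then 2 * p ord0 i - 1 else 1
  else 1.

Lemma upar0 p : upar p 0 = 1.
Proof. by []. Qed.

Lemma upar_in p (i : 'I_m) : upar p i.+1 = 2 * p ord0 i - 1.
Proof. by rewrite /upar valK. Qed.

Lemma upar_last p : upar p m.+1 = 1.
Proof. by rewrite /upar insubF// ltnn. Qed.

Lemma uparP (Q : nat -> R -> Prop) p :
  (forall k, Q k 1) -> (forall i : 'I_m, Q i.+1 (2 * p ord0 i - 1)) ->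
  forall k, Q k (upar p k).
Proof.
move=> h1 h2 [|k]; rewrite /upar //; case: insubP => [i _ <-|_]; [exact: h2|exact: h1].
Qed.

Arguments upar : simpl never.

Section StuntedMap.
Variable p : 'rV[R]_m.
Hypothesis Pp : Pm R m p.
Local Notation f := (stunted_sawtooth sigma p).
Local Notation u := (upar p).

Lemma upar_bounds k : -1 <= u k <= 1.
Proof.
have [p01 _] := Pp; apply: (uparP (Q := fun _ x => -1 <= x <= 1)) => [_|i].
  by apply/andP; split; lra.
by have := p01 i; move=> /andP[? ?]; apply/andP; split; lra.
Qed.

Lemma in_plateauE y i :
  in_plateau sigma p y i = (`|y - Chat i| <= 1 - u i.+1 * (a / s)).
Proof. by rewrite /in_plateau plateau_widthE// upar_in. Qed.

Lemma plateau_valueE i :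
  plateau_value sigma p i = - u i.+1 * sigma (lift ord0 i) * a.
Proof. by rewrite /plateau_value upar_in. Qed.

Lemma sigma_pre_div (j : 'I_m.+1) y : sigma j * y = sigma j * y / s * s.
Proof. by rewrite divfK// gt_eqF// slope_gt0. Qed.

(** The inequalities are closed, so the point may touch a plateau; then it is an end of the plateau
    at one of the two turning points of its lap, where both formulas agree. *)
Lemma stunted_branch (j : 'I_m.+1) y : `|y| <= a ->
  - u j * a <= sigma j * y <= u j.+1 * a -> f (branch sigma j y) = y.
Proof.
have [s1 r0 r1 aE a0] := @slope_alpha R m m_gt0.
have s0 : 0 < s by apply: lt_trans s1.
move=> hy /andP[l h]; set x := branch sigma j y.
have xE : x = Ihat j + sigma j * y / s by [].
have sy := sigma_sqr sigma_alt j.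
have yE : y = sigma j * (sigma j * y) by rewrite mulrA sy mul1r.
set t := sigma j * y / s in xE.
have {}l : - u j * (a / s) <= t by rewrite /t mulrA ler_pM2r ?invr_gt0.
have {}h : t <= u j.+1 * (a / s) by rewrite /t mulrA ler_pM2r ?invr_gt0.
have tE : sigma j * y = t * s by exact: sigma_pre_div.
have ra : a / s * s = a by rewrite divfK// gt_eqF.
have tr : `|t| <= a / s.
  by rewrite /t !normrM (sigma_norm sigma_alt) mul1r normfV (gtr0_norm s0) ler_pM2r ?invr_gt0.
have := tr; rewrite ler_norml => /andP[tl th].
have [[i hi]|off] : (exists i, in_plateau sigma p x i) \/ (forall i, ~~ in_plateau sigma p x i).
- by case: (pickP (in_plateau sigma p x)) => [i hi|off]; [left; exists i|right => i; rewrite off].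
- rewrite (stunted_sawtooth_plateau sigma_alt Pp hi) plateau_valueE.
  move: hi; rewrite in_plateauE ler_norml /Chat xE /Ihat => /andP[hi1 hi2].
  have /andP[ub1 ub2] := upar_bounds i.+1.
  have ur : u i.+1 * (a / s) <= a / s by rewrite ler_piMl// ltW.
  have ur' : - (a / s) <= u i.+1 * (a / s) by rewrite -mulN1r ler_pM2r.
  have [ij|ji|ij] := ltngtP i.+1 j.
  + have : ((i.+2)%:R : R) <= j%:R by rewrite ler_nat.
    by rewrite -(natr1 i.+1) => ?; exfalso; lra.
  + have [ji'|ji'] : (j < i)%N \/ nat_of_ord j = i.
      by move: ji; rewrite ltnS leq_eqVlt => /orP[/eqP|]; [right|left].
      have : (j.+1%:R : R) <= i%:R by rewrite ler_nat.
      by move: hi1 hi2; rewrite -!natr1 => ? ? ?; exfalso; lra.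
    have lE : lift ord0 i = j.+1 :> nat by rewrite lift0 ji'.
    move: hi1 hi2; rewrite (sigmaS sigma_alt lE) -ji' -(natr1 j) => hi1 hi2.
    have te : t = u j.+1 * (a / s) by lra.
    have {}tE : sigma j * y = u j.+1 * a by rewrite tE te -mulrA ra.
    by rewrite [RHS]yE tE; ring.
  + have lE : lift ord0 i = j by apply: ord_inj; rewrite lift0.
    rewrite lE -ij in l *; rewrite -ij in hi1 hi2.
    have te : t = - u i.+1 * (a / s) by lra.
    have {}tE : sigma j * y = - u i.+1 * a by rewrite tE te -mulrA ra.
    by rewrite [RHS]yE tE; ring.
rewrite stunted_sawtooth_off// (sawtoothE sigma_alt (j := j)) xE addrAC subrr add0r.
  by rewrite -mulrA (mulrC s) -tE -yE.
exact: le_trans tr (ltW r1).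
Qed.

Lemma plateau_or_branch x : `|x| <= a -> (exists i, in_plateau sigma p x i) \/
  exists j y, [/\ x = branch sigma j y, `|y| <= a & - u j * a <= sigma j * y <= u j.+1 * a].
Proof.
have [s1 r0 r1 aE a0] := @slope_alpha R m m_gt0.
have s0 : 0 < s by apply: lt_trans s1.
move=> hx; have [j hj] : exists j : 'I_m.+1, `|x - Ihat j| <= 1.
  by apply: J_cover => //; rewrite /J /= in_itv /= -ler_norml.
case: (pickP (in_plateau sigma p x)) => [i hi|off]; [by left; exists i|right].
set t := x - Ihat j in hj; have xE : x = Ihat j + t by rewrite /t; ring.
have ra : a / s * s = a by rewrite divfK// gt_eqF.
have {}off (i : 'I_m) : 1 - u i.+1 * (a / s) < `|x - Chat i|.
  by rewrite ltNge -in_plateauE off.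
move: hx hj; rewrite !ler_norml => /andP[hx1 hx2] /andP[hj1 hj2].
have tl : - u j * (a / s) <= t.
  have [j0|j0] := posnP j.
    by rewrite xE /Ihat j0 in hx1; rewrite j0 upar0 mulN1r; lra.
  have jm : (j.-1 < m)%N by rewrite prednK// -ltnS.
  have := off (Ordinal jm); rewrite /Chat /= prednK// xE /Ihat.
  by rewrite ger0_norm; lra.
have th : t <= u j.+1 * (a / s).
  have [jm|] := ltnP j m; last first.
    rewrite leq_eqVlt ltnNge -ltnS ltn_ord orbF => /eqP jm.
    by rewrite xE /Ihat -jm in hx2; rewrite -jm upar_last mul1r; lra.
  have := off (Ordinal jm); rewrite /Chat /= -(natr1 j) xE /Ihat.
  by rewrite ler0_norm; lra.
exists j, (sigma j * s * t).
have E : sigma j * (sigma j * s * t) = t * s.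
  by rewrite mulrA mulrA (sigma_sqr sigma_alt) mul1r mulrC.
have l : - u j * a <= t * s by rewrite -ra mulrA ler_pM2r.
have h : t * s <= u j.+1 * a by rewrite -ra mulrA ler_pM2r.
have /andP[ub1 ub2] := upar_bounds j; have /andP[vb1 vb2] := upar_bounds j.+1.
have ua : u j * a <= a by rewrite ler_piMl// ltW.
have va : u j.+1 * a <= a by rewrite ler_piMl// ltW.
split; last by rewrite E l h.
  by rewrite /branch E mulfK// ?gt_eqF.
by rewrite (sigma_norm_le sigma_alt j) E; apply/andP; split; lra.
Qed.

Lemma iter_pre w z k : ok sigma u w z -> (k <= size w)%N ->
  iter k f (pre sigma w z) = pre sigma (drop k w) z.
Proof.
elim: w k => [|j w IH] [|k] //= /andP[ow hj]; rewrite ltnS => kw.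
rewrite -iterS iterSr stunted_branch//; first exact: IH.
by apply: (pre_le m_gt0 sigma_alt); exact: ok_le ow.
Qed.

Lemma orbit_until_plateau n x : `|x| <= a -> exists w z,
  [/\ ok sigma u w z, x = pre sigma w z, (size w <= n)%N &
      size w = n \/ exists i, in_plateau sigma p z i].
Proof.
elim: n x => [|n IH] x hx; first by exists [::], x; split => //; left.
have [[i hi]|[j [y [xE hy hj]]]] := plateau_or_branch hx.
  by exists [::], x; split => //; right; exists i.
have [w [z [ow yE sw tE]]] := IH y hy.
exists (j :: w), z; split => //=.
- by rewrite ow -yE.
- by rewrite -yE.
- by case: tE => [->|?]; [left|right].
Qed.

(** One point is chosen per admissible word; different words come apart by [gap] at some time below
    n. *)
Lemma separated_card_lb n e : 0 < e -> e <= @gap R m ->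
  ((cnt sigma u n)%:R%:E <= separated_card (J R m) f n e)%E.
Proof.
move=> e0 eg.
have ex w : exists z, adm sigma u w -> ok sigma u w z.
  have [/asboolP[z oz]|nw] := boolP (adm sigma u w); first by exists z.
  by exists 0.
pose z w := projT1 (cid (ex w)).
have zP w : adm sigma u w -> ok sigma u w (z w) by exact: projT2 (cid (ex w)).
pose ws := [seq w <- words letters n | adm sigma u w].
have wsP w : w \in ws -> size w = n /\ ok sigma u w (z w).
  by rewrite mem_filter mem_words => /and3P[/zP ow /eqP sw _].
pose xs := [seq pre sigma w (z w) | w <- ws].
have uxs : uniq xs.
  rewrite map_inj_in_uniq; first by rewrite filter_uniq// words_uniq// enum_uniq.
  move=> w w' /wsP[sw ow] /wsP[sw' ow'].
  by apply: (pre_inj m_gt0 sigma_alt); rewrite ?sw ?sw'//; [exact: ok_le ow|exact: ok_le ow'].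
have cE : #|` [fset x in xs]%fset|%fset = cnt sigma u n.
  rewrite card_fseq undup_id// size_map /cnt -big_mkcond sum1_count size_filter //.
rewrite -cE; apply: separated_card_ge.
  move=> x /=; rewrite inE => /mapP[w /wsP[_ /ok_le hz] ->].
  by rewrite /J /= in_itv /= -ler_norml (pre_le m_gt0 sigma_alt).
move=> x y /=; rewrite !inE => /mapP[w /wsP[sw ow] ->] /mapP[w' /wsP[sw' ow'] ->] xy.
have ww : w != w' by apply/eqP => ww; apply: xy; rewrite ww.
have [_ [k kw hk]] := pre_gap m_gt0 sigma_alt (etrans sw (esym sw')) ww (ok_le ow) (ok_le ow').
exists k; first by rewrite -sw.
rewrite !iter_pre ?(ltnW kw)// ?sw' ?sw ?(ltnW kw)//; last by rewrite -sw ltnW.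
by rewrite /ball /= => hb; move: hk; rewrite leNgt (lt_le_trans hb).
Qed.

(** A point is encoded by its word up to time n or the first plateau, the index of that plateau (a
    dummy if none is met) and the cell of size e containing the end point. Equal codes keep orbits
    e-close: before the plateau because [pre] contracts, afterwards because they coincide. *)
Lemma separated_card_ub n e : 0 < e ->
  (separated_card (J R m) f n e <=
   ((m * (Num.truncn (2 * a / e)).+1) * \sum_(k < n.+1) cnt sigma u k)%N%:R%:E)%E.
Proof.
have [s1 r0 r1 aE a0] := @slope_alpha R m m_gt0.
have s0 : 0 < s by apply: lt_trans s1.
move=> e0; apply: ge_ereal_sup => _ [E [EJ sE] <-]; rewrite lee_fin ler_nat.
pose good x (d : seq 'I_m.+1 * R * 'I_m) := [/\ ok sigma u d.1.1 d.1.2,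
  x = pre sigma d.1.1 d.1.2, (size d.1.1 <= n)%N &
  size d.1.1 = n \/ in_plateau sigma p d.1.2 d.2].
have ex x : exists d, x \in E -> good x d.
  have [xE|] := boolP (x \in E); last by exists ([::], 0, Ordinal m_gt0).
  have hx : `|x| <= a by have := EJ x xE; rewrite /J /= in_itv /= -ler_norml.
  have [w [z [ow xw sw tE]]] := orbit_until_plateau n hx.
  case: tE => [sn|[i hi]].
    by exists (w, z, Ordinal m_gt0) => _; split => //; left.
  by exists (w, z, i) => _; split => //; right.
pose d x := projT1 (cid (ex x)).
have dP x : x \in E -> good x (d x) by exact: projT2 (cid (ex x)).
pose cell x := Num.truncn (((d x).1.2 + a) / e).
pose Pw := flatten [seq [seq w <- words letters k | adm sigma u w] | k <- index_iota 0 n.+1].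
pose data := [seq (x, y) | x <- Pw, y <- [seq (x, y) | x <- enum 'I_m,
   y <- iota 0 (Num.truncn (2 * a / e)).+1]].
pose key x := ((d x).1.1, ((d x).2, cell x)).
have sd : size data = ((m * (Num.truncn (2 * a / e)).+1) * \sum_(k < n.+1) cnt sigma u k)%N.
  rewrite /data !size_allpairs size_iota size_enum_ord mulnC; congr (_ * _)%N.
  rewrite /Pw size_flatten /shape -map_comp sumnE big_map big_mkord.
  by apply: eq_bigr => k _ /=; rewrite size_filter -sum1_count big_mkcond.
rewrite -sd; rewrite -(size_map key (enum_fset E)); apply: uniq_leq_size.
  rewrite map_inj_in_uniq ?fset_uniq// => x y xE yE [ew ei ec].
  have [ox xw sx tx] := dP x xE; have [oy yw sy ty] := dP y yE.
  apply: contrapT => xy; have [k kn] := sE x y xE yE xy; apply.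
  have clo : `|(d x).1.2 - (d y).1.2| < e.
    have ge0 v : `|v| <= a -> 0 <= (v + a) / e.
      by rewrite ler_norml => /andP[v1 _]; rewrite divr_ge0 ?(ltW e0)//; lra.
    have := truncn_eq_dist (ge0 _ (ok_le ox)) (ge0 _ (ok_le oy)) ec.
    by rewrite -mulrBl normrM normfV (gtr0_norm e0) ltr_pdivrMr// mul1r opprD addrACA subrr addr0.
  have [kw|kw] := leqP k (size (d x).1.1).
    rewrite xw yw ew !iter_pre// -?ew//.
    rewrite /ball /= (pre_norm m_gt0 sigma_alt); apply: le_lt_trans clo.
    by rewrite ler_pdivrMr ?exprn_gt0// ler_peMr ?exprn_ege1// ltW.
  have pl v w : ok sigma u w v -> (size w < k)%N ->
     iter k f (pre sigma w v) = iter (k - (size w).+1) f (f v).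
    move=> ow wk; rewrite -{1}(subnK wk) iterD iterS iter_pre//.
    by rewrite drop_size.
  have nn : size (d x).1.1 <> n by move=> h; move: kw; rewrite h ltnNge ltnW.
  case: tx => [//|px]; case: ty => [h|py]; first by case: nn; rewrite ew.
  rewrite xw yw !pl// -?ew//.
  rewrite (stunted_sawtooth_plateau sigma_alt Pp px) ei.
  by rewrite (stunted_sawtooth_plateau sigma_alt Pp py); exact: ballxx.
move=> _ /mapP[x xE ->]; have [ox _ sx _] := dP x xE.
have hz := ok_le ox; rewrite /key; apply: allpairs_f.
  apply/flattenP; exists [seq w <- words letters (size (d x).1.1) | adm sigma u w].
    by apply/mapP; exists (size (d x).1.1) => //; rewrite mem_index_iota.
  rewrite mem_filter mem_words eqxx; apply/andP; split.
    by apply/asboolP; exists (d x).1.2.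
  by apply/allP => j _; rewrite /= mem_enum.
apply: allpairs_f; first by rewrite mem_enum.
rewrite mem_iota /= add0n ltnS; apply: le_truncn.
by rewrite ler_pM2r ?invr_gt0//; move: hz; rewrite ler_norml; lra.
Qed.

End StuntedMap.

Lemma entropy_le_of_grow p (x y : R) : Pm R m p -> 1 <= x -> x < y ->
  grow (cnt sigma (upar p)) x ->
  (topological_entropy (J R m) (stunted_sawtooth sigma p) <= (ln y)%:E)%E.
Proof.
move=> Pp x1 xy g; have x0 : 0 < x by apply: lt_le_trans x1.
have y0 : 0 < y by apply: lt_trans xy.
apply: topological_entropy_le => // e e0.
set t := (x + y) / 2; have xt : x < t by rewrite /t; lra.
have ty : t < y by rewrite /t; lra.
have t0 : 0 < t by apply: lt_trans xt.
have [C C0 HC] := growW t0 (grow_sum x1 xt g).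
have [D D0 HD] := linear_le_exp t0 ty.
set c := (m * (Num.truncn (2 * @alpha R m / e)).+1)%N.
have cCD : 0 <= c%:R * C * D by rewrite !mulr_ge0// ltW.
exists (Num.bound (c%:R * C * D)) => n hn.
apply: (le_trans (separated_card_ub Pp n e0)); rewrite lee_fin natrM.
apply: le_trans (ler_wpM2l _ (HC n)) _ => //; rewrite mulrA.
have hb : c%:R * C * D <= n.+1%:R.
  by apply: ltW; apply: lt_le_trans (archi_boundP cCD) _; rewrite ler_nat ltnW.
rewrite -(ler_pM2r D0) mulrAC [leRHS]mulrC; apply: le_trans (HD n).
by rewrite ler_pM2r// exprn_gt0.
Qed.

Lemma grow_of_entropy_lt p (x : R) : Pm R m p -> 0 < x ->
  (topological_entropy (J R m) (stunted_sawtooth sigma p) < (ln x)%:E)%E ->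
  exists N, forall n, (N <= n)%N -> (cnt sigma (upar p) n)%:R < x ^+ n.
Proof.
move=> Pp x0 lt; have [N HN] := topological_entropy_lt x0 (@gap_gt0 R m m_gt0) lt.
exists N => n Nn; rewrite -lte_fin; apply: le_lt_trans (HN n Nn).
by apply: separated_card_lb => //; exact: gap_gt0.
Qed.

End Bridge.

(** * Entropy as a function of the parameter *)

Section Isentropes.
Context {R : realType} {m : nat}.
Variable sigma : 'I_m.+1 -> R.
Hypothesis m_gt0 : (0 < m)%N.
Hypothesis sigma_alt : alternating_signs sigma.
Implicit Types (p q : 'rV[R]_m) (x y t d : R).

Definition entropy p := topological_entropy (J R m) (stunted_sawtooth sigma p).

Lemma rate_between (b c : \bar R) : (b < c)%E -> (0 <= c)%E ->
  exists2 x, 0 < x & (b < (ln x)%:E < c)%E.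
Proof.
move=> bc c0; have [r hr] : exists r : R, (b < r%:E < c)%E.
  move: b c bc c0 => [b| |] [c| |] //= bc c0.
  - exists ((b + c) / 2); move: bc; rewrite !lte_fin => bc.
    by apply/andP; split; lra.
  - by exists (b + 1); rewrite lte_fin ltrDl ltr01 ltry.
  - by exists (c - 1); rewrite ltNyr lte_fin; lra.
  - by exists 0; rewrite ltNyr ltry.
by exists (expR r); rewrite ?expR_gt0// expRK.
Qed.

Lemma entropy_rate p x : Pm R m p -> 0 < x -> (entropy p < (ln x)%:E)%E ->
  1 < x /\ exists2 n, (0 < n)%N & (cnt sigma (upar p) n)%:R < x ^+ n.
Proof.
move=> Pp x0 lt; split; last first.
  have [N HN] := grow_of_entropy_lt m_gt0 sigma_alt Pp x0 lt.
  by exists N.+1 => //; apply: HN.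
(* A singleton is separated, so the cardinality is at least 1 and its bound x^n forces x > 1. *)
have [N HN] := topological_entropy_lt x0 ltr01 lt.
have [_ _ _ _ a0] := @slope_alpha R m m_gt0.
have := HN N.+1 (leqnSn N); rewrite ltNge => /negP; apply: contra_notT.
rewrite -leNgt => x1.
apply: le_trans (@separated_card_ge _ _ _ _ _ _ [fset 0]%fset _ _).
- by rewrite cardfs1 lee_fin exprn_ile1// ltW.
- by move=> y /=; rewrite inE => /eqP ->; rewrite /J /= in_itv /= oppr_le0 ltW.
- by move=> y z /=; rewrite !inE => /eqP -> /eqP ->.
Qed.

Lemma entropy_ge0 p : Pm R m p -> (0 <= entropy p)%E.
Proof.
move=> Pp; rewrite leNgt; apply/negP => lt0.
by have [] := @entropy_rate p 1 Pp ltr01; rewrite ?ln1// ltxx.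
Qed.

Lemma grow_of_rate p x n : 0 < x -> (0 < n)%N ->
  (cnt sigma (upar p) n)%:R < x ^+ n -> grow (cnt sigma (upar p)) x.
Proof.
move=> x0 n0 h; apply: (grow_submul n0 x0 _ (ltW h)) => i j.
exact: cnt_submul.
Qed.

Lemma entropy_le_grow p q : Pm R m p -> Pm R m q ->
  (forall x y, 1 <= x -> x < y -> grow (cnt sigma (upar q)) x ->
     grow (cnt sigma (upar p)) y) ->
  (entropy p <= entropy q)%E.
Proof.
move=> Pp Pq H; rewrite leNgt; apply/negP => lt.
have [x x0 /andP[qx xp]] := rate_between lt (entropy_ge0 Pp).
have [y y0 /andP[xy yp]] := rate_between xp (entropy_ge0 Pp).
have [x1 [n n0 hn]] := entropy_rate Pq x0 qx.
have {}xy : x < y by move: xy; rewrite lte_fin ltr_ln ?posrE.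
have g : grow (cnt sigma (upar p)) ((x + y) / 2).
  by apply: (H x); rewrite ?(ltW x1)//; [lra|exact: grow_of_rate hn].
move: yp; rewrite ltNge => /negP; apply.
by apply: (entropy_le_of_grow m_gt0 sigma_alt Pp _ _ g); lra.
Qed.

Lemma upar_le p q d : 0 <= d -> (forall i, p ord0 i <= q ord0 i + d) ->
  forall k, upar p k <= upar q k + 2 * d.
Proof.
move=> d0 pq [|k]; first by rewrite !upar0; lra.
by rewrite /upar; case: insubP => [i _ _|_]; [have := pq i; lra|lra].
Qed.

Lemma entropy_mono p q : Pm R m p -> Pm R m q ->
  (forall i, p ord0 i <= q ord0 i) -> (entropy p <= entropy q)%E.
Proof.
move=> Pp Pq pq; apply: entropy_le_grow => // x y x1 xy g.
apply: (grow_mono (x := x)); [exact: lt_le_trans x1|exact: ltW|].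
apply: grow_le g => n; apply: cnt_mono => // j.
by have := @upar_le p q 0 (lexx 0) _ j; rewrite mulr0 addr0; apply => i; rewrite addr0.
Qed.

(** The strict inequality for [cnt] at one length n persists by [cnt_usc] and determines a rate by
    submultiplicativity. The halved radius reflects u = 2 p - 1. *)
Lemma entropy_usc p (b : R) : Pm R m p -> 0 <= b -> (entropy p < b%:E)%E ->
  exists2 d, 0 < d & forall q, Pm R m q -> (forall i, q ord0 i <= p ord0 i + d) ->
    (entropy q < b%:E)%E.
Proof.
move=> Pp b0 pb; have b0' : (0 <= b%:E)%E by rewrite lee_fin.
have [x x0 /andP[px xb]] := rate_between pb b0'.
have [y y0 /andP[xy yb]] := rate_between xb b0'.
have {}xy : x < y by move: xy; rewrite lte_fin ltr_ln ?posrE.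
have [x1 [n n0 hn]] := entropy_rate Pp x0 px.
have [d d0 hd] := cnt_usc m_gt0 sigma_alt (upar p) n.
exists (d / 2) => [|q Pq qp]; first by rewrite divr_gt0.
apply: le_lt_trans yb; apply: (entropy_le_of_grow m_gt0 sigma_alt Pq (ltW x1) xy).
apply: (grow_of_rate x0 n0); apply: le_lt_trans hn; rewrite ler_nat; apply: hd => j.
have -> : d = 2 * (d / 2) by lra.
by apply: upar_le => //; rewrite divr_ge0// ltW.
Qed.

Lemma entropy_lsc p (b : R) : Pm R m p -> 0 <= b -> (b%:E < entropy p)%E ->
  exists2 d, 0 < d & forall q, Pm R m q -> (forall i, p ord0 i - d <= q ord0 i) ->
    (b%:E < entropy q)%E.
Proof.
move=> Pp b0 bp; have p0 := entropy_ge0 Pp.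
have [x x0 /andP[bx xp]] := rate_between bp p0.
have [z z0 /andP[xz zp]] := rate_between xp p0.
have {}xz : x < z by move: xz; rewrite lte_fin ltr_ln ?posrE.
have x1 : 1 <= x.
  rewrite leNgt; apply/negP => x1; move: bx; rewrite lte_fin ltNge => /negP; apply.
  by apply: le_trans b0; rewrite ln_le0// ltW.
have [y xy yz] : exists2 y, x < y & y < z by exists ((x + z) / 2); lra.
have ng : ~ grow (cnt sigma (upar p)) y.
  move=> g; move: zp; rewrite ltNge => /negP; apply.
  exact: (entropy_le_of_grow m_gt0 sigma_alt Pp (le_trans x1 (ltW xy)) yz g).
have u1 k : upar p k <= 1 by have /andP[] := upar_bounds Pp k.
have [d d0 hd] := cnt_lsc m_gt0 sigma_alt u1 x1 xy ng.
exists (d / 2) => [|q Pq qp]; first by rewrite divr_gt0.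
apply: lt_le_trans bx _; rewrite leNgt; apply/negP => lt.
have [_ [n n0 hn]] := entropy_rate Pq x0 lt.
apply: (hd (upar q)) (grow_of_rate x0 n0 hn) => k.
rewrite lerBlDr (_ : d = 2 * (d / 2)); last by lra.
apply: upar_le => [|i]; first by rewrite divr_ge0// ltW.
by have := qp i; lra.
Qed.

(** * Clamping and raising the parameter *)

Definition clamp t p : 'rV[R]_m :=
  \row_i Num.max (t / 2) (Num.min (p ord0 i) (1 - t / 2)).

Lemma clampE t p i : t <= 1 ->
  [\/ clamp t p ord0 i = t / 2 /\ p ord0 i <= t / 2,
      clamp t p ord0 i = p ord0 i /\ t / 2 <= p ord0 i <= 1 - t / 2 |
      clamp t p ord0 i = 1 - t / 2 /\ 1 - t / 2 <= p ord0 i].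
Proof.
move=> t1; rewrite mxE; case: (leP (p ord0 i) (1 - t / 2)) => h.
  case: (leP (t / 2) (p ord0 i)) => h'; first by constructor 2.
  by constructor 1; rewrite ltW.
case: (leP (t / 2) (1 - t / 2)) => h'; first by constructor 3; rewrite ltW.
lra.
Qed.

(** The interval is symmetric about 1/2: if a coordinate is at most t/2, its neighbours are at least
    1 - t/2, and the clamped sum is exactly 1. *)
Lemma clamp_Pm t p : 0 <= t <= 1 -> Pm R m p -> Pm R m (clamp t p).
Proof.
move=> /andP[t0 t1] [p01 pS]; split => [i|i i' ii'].
  by have := p01 i; case: (clampE p i t1) => -[-> h] /andP[? ?]; apply/andP; split; lra.
have := pS i i' ii'; case: (clampE p i t1) => -[-> hi];
  case: (clampE p i' t1) => -[-> hi'] h; try move/andP: hi => [? ?];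
  try move/andP: hi' => [? ?]; lra.
Qed.

Lemma entropy_clamp t p : 0 <= t <= 1 -> Pm R m p -> (entropy (clamp t p) <= entropy p)%E.
Proof.
move=> t01 Pp; have /andP[t0 t1] := t01; apply: entropy_le_grow => //.
  exact: clamp_Pm.
have inner (Q : nat -> Prop) : (forall i : 'I_m, Q i.+1) -> forall j, (0 < j <= m)%N -> Q j.
  by move=> h [|j] // /andP[_ jm]; exact: (h (Ordinal jm)).
move=> x y; apply: (@grow_clamped _ _ sigma m_gt0 sigma_alt _ (1 - t)).
- by apply/andP; split; lra.
- exact: upar0.
- exact: upar_last.
- apply: inner => i; rewrite upar_in.
  by case: (clampE p i t1) => -[-> h]; try move/andP: h => [? ?]; lra.
- exact: upar0.
- exact: upar_last.
(* Clamping raises only the coordinates with u <= -(1 - t), and these become exactly -(1 - t). *)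
- apply: inner => i; rewrite !upar_in.
  case: (clampE p i t1) => -[-> h]; [right|left|left]; [split| |]; lra.
Qed.

Lemma center_Pm : Pm R m (const_mx (1 / 2)).
Proof.
by split => [i|i i' _]; rewrite !mxE; [apply/andP; split|]; lra.
Qed.

Lemma clamp1 p : clamp 1 p = const_mx (1 / 2).
Proof.
by apply/rowP => i; case: (clampE p i (lexx 1)) => -[-> h]; rewrite mxE; move: h; lra.
Qed.

Lemma clamp0 p : Pm R m p -> clamp 0 p = p.
Proof.
move=> [p01 _]; apply/rowP => i; have := p01 i => /andP[? ?].
by case: (clampE p i ler01) => -[-> h]; move: h; lra.
Qed.

Lemma entropy_center : (entropy (const_mx (1 / 2)%R : 'rV[R]_m) <= 0)%E.
Proof.
rewrite leNgt; apply/negP => lt.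
have [y y0 /andP[y1 yh]] := rate_between lt (ltW lt).
have {}y1 : 1 < y by move: y1; rewrite lte_fin -[0]ln1 ltr_ln ?posrE.
move: yh; rewrite ltNge => /negP; apply.
have z1 : 1 < (1 + y) / 2 by lra.
apply: (entropy_le_of_grow m_gt0 sigma_alt center_Pm (ltW z1)); first by lra.
apply: (@grow_clamped0 _ _ sigma m_gt0 sigma_alt _ 0) => //.
  by rewrite lexx ler01.
move=> [|j] // /andP[_ jm].
by have := @upar_in R m (const_mx (1 / 2)) (Ordinal jm); rewrite mxE /= => ->; lra.
Qed.

Definition raise t p : 'rV[R]_m := \row_i Num.min (p ord0 i + t) 1.

(** Truncation respects the constraint, since a coordinate equal to 1 is compatible with any
    neighbour. *)
Lemma raise_Pm t p : 0 <= t -> Pm R m p -> Pm R m (raise t p).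
Proof.
move=> t0 [p01 pS]; split => [i|i i' ii']; rewrite !mxE.
  have /andP[? ?] := p01 i.
  by case: (leP (p ord0 i + t) 1) => ?; apply/andP; split; lra.
have := pS i i' ii'; have /andP[? ?] := p01 i; have /andP[? ?] := p01 i'.
by case: (leP (p ord0 i + t) 1) => ?; case: (leP (p ord0 i' + t) 1) => ? ?; lra.
Qed.

Lemma raise0 p : Pm R m p -> raise 0 p = p.
Proof.
move=> [p01 _]; apply/rowP => i; rewrite mxE addr0 min_l//.
by have /andP[] := p01 i.
Qed.

Lemma raise1 p : Pm R m p -> raise 1 p = const_mx 1.
Proof.
move=> [p01 _]; apply/rowP => i; rewrite !mxE min_r//.
by have /andP[? ?] := p01 i; lra.
Qed.

Lemma entropy_top : ((ln m.+1%:R)%:E <= entropy (const_mx 1%R : 'rV[R]_m))%E.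
Proof.
have P1 : Pm R m (const_mx 1) by split => [i|i i' _]; rewrite !mxE; [apply/andP; split|]; lra.
rewrite leNgt; apply/negP => lt.
have [_ [n n0]] := entropy_rate P1 (ltr0Sn R m) lt.
have -> : cnt sigma (upar (const_mx 1 : 'rV[R]_m)) n = (m.+1 ^ n)%N.
  rewrite -(cnt_full m_gt0 sigma_alt); apply: anti_leq.
  have u1 k : upar (const_mx 1 : 'rV[R]_m) k = 1.
    case: k => [|k]; first exact: upar0.
    by rewrite /upar; case: insubP => // i _ _; rewrite mxE; lra.
  by rewrite !cnt_mono// => k; rewrite u1.
by rewrite natrX ltxx.
Qed.

End Isentropes.

(** * Contraction of a level set *)

Section Contraction.
Context {R : realType} {m : nat}.
Implicit Types (p q : 'rV[R]_m) (t d : R).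
Variables (entropy : 'rV[R]_m -> \bar R) (h0 : R).
Hypothesis m_gt0 : (0 < m)%N.
Hypothesis entropy_mono : forall p q, Pm R m p -> Pm R m q ->
  (forall i, p ord0 i <= q ord0 i) -> (entropy p <= entropy q)%E.
Hypothesis entropy_usc : forall p, Pm R m p -> (entropy p < h0%:E)%E ->
  exists2 d, 0 < d & forall q, Pm R m q -> (forall i, q ord0 i <= p ord0 i + d) ->
    (entropy q < h0%:E)%E.
Hypothesis entropy_lsc : forall p, Pm R m p -> (h0%:E < entropy p)%E ->
  exists2 d, 0 < d & forall q, Pm R m q -> (forall i, p ord0 i - d <= q ord0 i) ->
    (h0%:E < entropy q)%E.
Hypothesis entropy_clamp : forall t p, 0 <= t <= 1 -> Pm R m p ->
  (entropy (clamp t p) <= entropy p)%E.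
Hypothesis entropy_center : (entropy (const_mx (1 / 2)%R) <= h0%:E)%E.
Hypothesis entropy_top : (h0%:E <= entropy (const_mx 1%R))%E.

Let hits p : set R := [set t | 0 <= t /\ (h0%:E <= entropy (raise t p))%E].

Definition hitting_time p : R := inf (hits p).

Definition retraction p := raise (hitting_time p) p.

Let hits1 p : Pm R m p -> hits p 1.
Proof.
by move=> Pp; split => //; rewrite raise1.
Qed.

Let hits_lb p : lbound (hits p) 0.
Proof. by move=> t []. Qed.

Lemma hitting_time_ge p x : Pm R m p ->
  (forall t, 0 <= t -> (h0%:E <= entropy (raise t p))%E -> x <= t) -> x <= hitting_time p.
Proof. by move=> Pp hx; apply: lb_le_inf; [exists 1; exact: hits1|move=> t [? ?]; exact: hx]. Qed.

Lemma hitting_time_ge0 p : Pm R m p -> 0 <= hitting_time p.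
Proof. by move=> Pp; exact: hitting_time_ge. Qed.

Lemma hitting_time_le p t : 0 <= t -> (h0%:E <= entropy (raise t p))%E ->
  hitting_time p <= t.
Proof. by move=> t0 ht; apply: ge_inf => //; exists 0; exact: hits_lb. Qed.

(* A uniform translation by d dominates every perturbation of size d. *)
Lemma hitting_time_lipschitz p q d : Pm R m p -> Pm R m q ->
  (forall i, `|p ord0 i - q ord0 i| <= d) -> `|hitting_time p - hitting_time q| <= d.
Proof.
move=> Pp Pq pq.
have d0 : 0 <= d by apply: le_trans (pq (Ordinal m_gt0)).
suff main p' q' : Pm R m p' -> Pm R m q' -> (forall i, `|p' ord0 i - q' ord0 i| <= d) ->
    hitting_time q' <= hitting_time p' + d.
  have h1 := main p q Pp Pq pq.
  have h2 : hitting_time p <= hitting_time q + d.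
    by apply: main => // i; rewrite distrC.
  move: (hitting_time p) (hitting_time q) h1 h2 => v v' h1 h2.
  by rewrite ler_norml; apply/andP; split; lra.
move=> Pp' Pq' pq'; rewrite -lerBlDr; apply: hitting_time_ge => // t t0 ht.
rewrite lerBlDr; apply: hitting_time_le; first exact: addr_ge0.
apply: le_trans ht _; apply: entropy_mono; try by apply: raise_Pm; rewrite ?addr_ge0.
move=> i; rewrite !mxE le_min ge_min ge_min lexx orbT andbT.
by have := pq' i; rewrite ler_norml => /andP[? ?]; apply/orP; left; lra.
Qed.

(** Upper semicontinuity shows that the infimum is attained; lower semicontinuity excludes an
    overshoot, which would persist at an earlier time. At time 0 no earlier time exists, and there
    the assumption on p is used. *)
Lemma entropy_retraction p : Pm R m p -> (entropy p <= h0%:E)%E ->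
  entropy (retraction p) = h0%:E.
Proof.
move=> Pp ph; have t0 := hitting_time_ge0 Pp.
rewrite /retraction; have tge := @hitting_time_ge p _ Pp; have tle := @hitting_time_le p.
move: (hitting_time p) t0 tge tle => t t0 tge tle.
have Pr := raise_Pm t0 Pp; apply/eqP; rewrite eq_le; apply/andP; split.
  rewrite leNgt; apply/negP => lt; have [d d0 hd] := entropy_lsc Pr lt.
  have := t0; rewrite le_eqVlt => /orP[/eqP t00|tp].
    by move: lt; rewrite -t00 raise0// ltNge ph.
  set t' := Num.max 0 (t - d).
  have t'0 : 0 <= t' by rewrite le_max lexx.
  have t't : t' < t by rewrite gt_max tp /=; lra.
  have : t <= t'.
    apply: tle => //; apply/ltW/hd; first exact: raise_Pm.
    have : t - d <= t' by rewrite le_max lexx orbT.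
    move=> h i; rewrite !mxE lerBlDr; move: h.
    by case: (leP (p ord0 i + t) 1) => ?; case: (leP (p ord0 i + t') 1) => ? ?; lra.
  by rewrite leNgt t't.
rewrite leNgt; apply/negP => lt; have [d d0 hd] := entropy_usc Pr lt.
have : t + d <= t.
  apply: tge => t' t'0 ht'; rewrite leNgt; apply/negP => t'd.
  move: ht'; rewrite leNgt => /negP; apply; apply: hd; first exact: raise_Pm.
  move=> i; rewrite !mxE.
  by case: (leP (p ord0 i + t) 1) => ?; case: (leP (p ord0 i + t') 1) => ?; lra.
lra.
Qed.

Lemma retraction_id p : Pm R m p -> entropy p = h0%:E -> retraction p = p.
Proof.
move=> Pp ph; rewrite /retraction (_ : hitting_time p = 0) ?raise0//.
apply/eqP; rewrite eq_le hitting_time_ge0// andbT; by apply: hitting_time_le; rewrite ?raise0// ph.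
Qed.

Lemma clamp_lipschitz t t' p q d : `|t - t'| <= d -> (forall i, `|p ord0 i - q ord0 i| <= d) ->
  t <= 1 -> t' <= 1 -> forall i, `|clamp t p ord0 i - clamp t' q ord0 i| <= d.
Proof.
move=> + pq t1 t'1 i; have := pq i; rewrite !ler_norml => /andP[? ?] /andP[? ?].
by case: (clampE p i t1) => -[-> hi]; case: (clampE q i t'1) => -[-> hi'];
  try move/andP: hi => [? ?]; try move/andP: hi' => [? ?]; apply/andP; split; lra.
Qed.

Lemma retraction_lipschitz p q d : Pm R m p -> Pm R m q ->
  (forall i, `|p ord0 i - q ord0 i| <= d) ->
  forall i, `|retraction p ord0 i - retraction q ord0 i| <= 2 * d.
Proof.
move=> Pp Pq pq i; have := hitting_time_lipschitz Pp Pq pq; have := pq i.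
rewrite /retraction !mxE !ler_norml => /andP[? ?].
move: (hitting_time p) (hitting_time q) => t t' /andP[? ?].
by case: (leP (p ord0 i + t) 1) => ?; case: (leP (q ord0 i + t') 1) => ?;
  apply/andP; split; lra.
Qed.

Lemma level_contractible :
  contractible R [set p | Pm R m p /\ entropy p = h0%:E].
Proof.
have down t p : 0 <= t <= 1 -> Pm R m p -> entropy p = h0%:E ->
    Pm R m (clamp t p) /\ (entropy (clamp t p) <= h0%:E)%E.
  by move=> t01 Pp ph; rewrite -ph; split; [exact: clamp_Pm|exact: entropy_clamp].
have retr p : Pm R m p -> (entropy p <= h0%:E)%E ->
    Pm R m (retraction p) /\ entropy (retraction p) = h0%:E.
  move=> Pp ph; split; last exact: entropy_retraction.
  by apply: raise_Pm => //; exact: hitting_time_ge0.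
exists (retraction (const_mx (1 / 2))), (fun tp => retraction (clamp tp.1 tp.2)).
split => /=.
- by apply: retr => //; exact: center_Pm.
- apply/subspace_continuousP => -[t p] [/= t01 [Pp ph]].
  apply/cvg_ballP => e e0; rewrite near_withinE.
  (* The retraction at most doubles distances, once for p and once for the hitting time; 2 (e / 3) <
     e gives the strict inequality. *)
  have e3 : 0 < e / 3 by lra.
  have : nbhs (t, p) (ball (t, p) (e / 3)) by exact: nbhsx_ballx.
  apply: filterS => -[t' q] [/= bt [_ bp]] [/= t'01 [Pq qh]].
  move: t01 t'01; rewrite !in_itv /= => t01 t'01.
  have [Pc _] := down t p t01 Pp ph; have [Pc' _] := down t' q t'01 Pq qh.
  have /andP[_ t1] := t01; have /andP[_ t'1] := t'01.
  split => // i j; rewrite [i]ord1 /from_subspace /ball /=.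
  apply: (@le_lt_trans _ _ (2 * (e / 3))); last by lra.
  apply: retraction_lipschitz => // k; apply: clamp_lipschitz => //.
    by move: bt; rewrite /ball /= => /ltW.
  by move=> l; have := bp ord0 l; rewrite /ball /= => /ltW.
- move=> t p; rewrite in_itv /= => t01 [Pp ph].
  by have [? ?] := down t p t01 Pp ph; exact: retr.
- by move=> p [Pp ph]; rewrite clamp0// retraction_id.
- by move=> p _; rewrite clamp1.
Qed.

End Contraction.

Theorem theorem6p1 (R : realType) (m : nat) (sigma : 'I_m.+1 -> R) (h0 : R)
    (m_ge1 : (1 <= m)%N) (sigma_alt : alternating_signs sigma)
    (h0_itv : 0 <= h0 <= ln (m.+1%:R)) :
  contractible R
    [set p | Pm R m p /\
             topological_entropy (J R m) (stunted_sawtooth sigma p) = h0%:E].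
Proof.
have /andP[h00 h01] := h0_itv.
apply: (level_contractible (entropy := entropy sigma) m_ge1).
- exact: entropy_mono.
- by move=> p Pp; exact: entropy_usc.
- by move=> p Pp; exact: entropy_lsc.
- exact: entropy_clamp.
- by apply: le_trans (entropy_center m_ge1 sigma_alt) _; rewrite lee_fin.
- by apply: le_trans (entropy_top m_ge1 sigma_alt); rewrite lee_fin.
Qed.
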